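(* Let $X$ be a quasi-Banach function space over $\mathcal P$ with absolutely continuous quasinorm, and suppose that there are constants $c>0$ and $Q>0$ such that $$\frac{\mu(B(y,r))}{\mu(B(x,R))}\ge c\Big(\frac rR\Big)^Q\quad\text{for every } x\in\mathcal P,\ 0<r\le R,\ y\in B(x,R).$$ Let $0<s\le1$ and let $u\in\dot M^{s,X}(\mathcal P)$ be quasicontinuous. (1) If $\alpha_X<\infty$, then quasievery point is a generalized Lebesgue point of $u$. (2) If $\alpha_X<(Q+s)/Q$, then quasievery point is a Lebesgue point of $u$.
   Context: Space. $\mathcal P=(\mathcal P,d,\mu)$ is a metric space $(\mathcal P,d)$ with a Borel regular outer measure $\mu$ such that every ball $B(x,r)=\{y\in\mathcal P: d(y,x)<r\}$ ($r>0$) has positive and finite measure, and $\mu$ is doubling: there is a constant $c_d>0$ with $\mu(B(x,2r))\le c_d\,\mu(B(x,r))$ for all $x\in\mathcal P$, $r>0$. $L^0=L^0(\mathcal P)$ is the set of measurable, almost everywhere finite functions $u:\mathcal P\to[-\infty,\infty]$. $\chi_E$ is the characteristic function of $E$. Quasi-Banach function spaces. A quasinorm on a subspace of $L^0$ is a functional $\|\cdot\|$ with: $\|f\|=0$ iff $f=0$ a.e.; $\|\alpha f\|=|\alpha|\|f\|$ for $\alpha\in\mathbb R$; $\|f+g\|\le c_\Delta(\|f\|+\|g\|)$ for some constant $c_\Delta$. A quasi-Banach function space $X$ over $\mathcal P$ is a subspace of $L^0(\mathcal P)$ with a complete quasinorm $\|\cdot\|_X$ such that: if $g\in X$ and $|f|\le|g|$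 a.e. then $f\in X$ and $\|f\|_X\le\|g\|_X$; if $\mu(E)<\infty$ then $\|\chi_E\|_X<\infty$; if $0\le f_k\uparrow f$ a.e. then $\|f_k\|_X\uparrow\|f\|_X$ (with $\|f\|_X=\infty$ for $f\notin X$). The quasinorm is absolutely continuous if $\|f\chi_{E_k}\|_X\to0$ whenever $f\in X$ and $(E_k)$ is a decreasing sequence of sets with $\bigcap_k E_k=\emptyset$. Hajłasz spaces. A measurable $g:\mathcal P\to[0,\infty]$ is an $s$-gradient of $u\in L^0$ if there is $E\subset\mathcal P$ with $\mu(E)=0$ such that $|u(x)-u(y)|\le d(x,y)^s(g(x)+g(y))$ for all $x,y\in\mathcal P\setminus E$. $\mathcal D^s(u)$ is the set of all $s$-gradients of $u$. $\dot M^{s,X}$ consists of measurable $u$ with $\|u\|_{\dot M^{s,X}}=\inf_{g\in\mathcal D^s(u)}\|g\|_X<\infty$; $M^{s,X}=\dot M^{s,X}\cap X$ with $\|u\|_{M^{s,X}}=\|u\|_X+\|u\|_{\dot M^{s,X}}$. Capacity. $C_{M^{s,X}}(E)=\inf\{\|u\|_{M^{s,X}}: u\in M^{s,X},\ u\ge1 \text{ on a neighbourhood of } E\}$. A property holds for quasievery point (quasieverywhere) if it holds outside a set of $M^{s,X}$-capacity zero. A function $u:\mathcal P\to[-\infty,\infty]$ is quasicontinuous if for every $\varepsilon>0$ there is $E\subset\mathcal P$ with $C_{M^{s,X}}(E)<\varepsilon$ such that the restriction of $u$ to $\mathcal P\setminus E$ is continuous. Medians and Boyd index. For $0<\gamma<1$,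 measurable $u$ and a set $A$ of finite measure, $m_u^\gamma(A)=\inf\{a\in\mathbb R:\mu(\{x\in A:u(x)>a\})<\gamma\mu(A)\}$, and $\mathcal M^\gamma u(x)=\sup_{r>0}m^\gamma_{|u|}(B(x,r))$. Define $\Phi_X:(0,1)\to[1,\infty]$ by $\Phi_X(\gamma)=\sup_{\|f\|_X\le1}\|\mathcal M^\gamma f\|_X$. The generalized upper Boyd index of $X$ is $\alpha_X=\lim_{\gamma\to0}\frac{\log\Phi_X(\gamma)}{\log(1/\gamma)}$. Lebesgue points. A point $x$ is a Lebesgue point of $u$ if $\lim_{r\to0}\frac1{\mu(B(x,r))}\int_{B(x,r)}u\,d\mu=u(x)$. It is a generalized Lebesgue point of $u$ if $\lim_{r\to0}m^\gamma_{|u-u(x)|}(B(x,r))=0$ and $\lim_{r\to0}m^\gamma_u(B(x,r))=u(x)$ for every $0<\gamma<1$. *)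

(* Defs.v *)
From HB Require Import structures.
From mathcomp Require Import all_boot all_order all_algebra.
From mathcomp Require Import all_classical all_reals all_analysis.
From mathcomp Require Import measurable_realfun.
Set Implicit Arguments.
Unset Strict Implicit.
Unset Printing Implicit Defensive.
Import Order.TTheory GRing.Theory Num.Def Num.Theory.
Import numFieldNormedType.Exports.

Local Open Scope classical_set_scope.
Local Open Scope ring_scope.

(* The distinguished point only says that the space is nonempty; the library
   puts the sigma-algebra of Caratheodory measurable sets on pointed types. *)
#[short(type="pmetricType")]
HB.structure Definition PMetric (R : numDomainType) :=
  {T of Metric R T & Pointed T}.

Section MeasureSpace.
Context {R : realType} {T : pmetricType R}.
Variable mu : {outer_measure set T -> \bar R}.
Local Open Scope ereal_scope.

Definition borel_regular :=
  <<s [set U : set T | open U] >> `<=` mu.-caratheodory /\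
  forall A : set T, exists B,
    [/\ <<s [set U : set T | open U] >> B, A `<=` B & mu A = mu B].

Definition balls_pos_finite :=
  forall (x : T) (r : R), (0 < r)%R -> 0 < mu (ball x r) < +oo.

Definition doubling := exists2 cd : R, (0 < cd)%R &
  forall (x : T) (r : R), (0 < r)%R ->
    mu (ball x (2 * r)%R) <= cd%:E * mu (ball x r).

(* mu restricted to the sigma-algebra of mu-measurable sets *)
Definition cara_measure : {measure set (caratheodory_type mu) -> \bar R} := mu.

(* Functions are compared almost everywhere but not quotiented, so that their
   pointwise values still make sense. *)
Definition mu_measurable_fun (u : T -> \bar R) :=
  @measurable_fun _ _ (caratheodory_type mu) (\bar R) setT u.

Definition L0 : set (T -> \bar R) :=
  [set u | mu_measurable_fun u /\ {ae cara_measure, forall x, u x \is a fin_num}].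

End MeasureSpace.

(* ||f||_X, with the convention ||f||_X = +oo outside X *)
Definition ext_norm {R : realType} {T : Type} (X : set (T -> \bar R))
    (N : (T -> \bar R) -> R) (f : T -> \bar R) : \bar R :=
  if f \in X then (N f)%:E else +oo%E.

(* The junk value of (+oo) + (-oo) is harmless in the sums and differences
   below: elements of X are finite almost everywhere. *)
Record qbfs {R : realType} {T : pmetricType R}
    (mu : {outer_measure set T -> \bar R}) := QBFS {
  qb_set : set (T -> \bar R) ;
  qb_norm : (T -> \bar R) -> R ;
  qb_L0 : qb_set `<=` L0 mu ;
  qb_zero : qb_set (cst 0%E) ;
  qb_add : forall f g, qb_set f -> qb_set g ->
    qb_set (fun x => f x + g x)%E ;
  qb_scale : forall (a : R) f, qb_set f -> qb_set (fun x => a%:E * f x)%E ;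
  qb_norm_ge0 : forall f, qb_set f -> 0 <= qb_norm f ;
  qb_norm_eq0 : forall f, qb_set f ->
    (qb_norm f = 0 <-> {ae cara_measure mu, forall x, f x = 0%E}) ;
  qb_normZ : forall (a : R) f, qb_set f ->
    qb_norm (fun x => a%:E * f x)%E = `|a| * qb_norm f ;
  qb_normD : exists c : R, forall f g, qb_set f -> qb_set g ->
    qb_norm (fun x => f x + g x)%E <= c * (qb_norm f + qb_norm g) ;
  qb_complete : forall f : nat -> T -> \bar R, (forall n, qb_set (f n)) ->
    (forall e : R, 0 < e -> exists N, forall m n, (N <= m)%N -> (N <= n)%N ->
      qb_norm (fun x => f m x - f n x)%E < e) ->
    exists2 g, qb_set g &
      qb_norm (fun x => f n x - g x)%E @[n --> \oo] --> 0 ;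
  qb_lattice : forall f g, mu_measurable_fun mu f -> qb_set g ->
    {ae cara_measure mu, forall x, `|f x| <= `|g x|}%E ->
    qb_set f /\ qb_norm f <= qb_norm g ;
  qb_indic : forall E : set T, mu.-caratheodory E -> (mu E < +oo)%E ->
    qb_set (EFin \o \1_E) ;
  qb_fatou : forall (f : nat -> T -> \bar R) (g : T -> \bar R),
    (forall n, mu_measurable_fun mu (f n)) -> mu_measurable_fun mu g ->
    {ae cara_measure mu, forall x,
      [/\ forall n, (0 <= f n x)%E,
          forall n, (f n x <= f n.+1 x)%E
        & f n x @[n --> \oo] --> g x]} ->
    (forall n, (ext_norm qb_set qb_norm (f n) <=
                ext_norm qb_set qb_norm (f n.+1))%E) /\
    ext_norm qb_set qb_norm (f n) @[n --> \oo] --> ext_norm qb_set qb_norm g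
}.

Section Hajlasz.
Context {R : realType} {T : pmetricType R}.
Variables (mu : {outer_measure set T -> \bar R}) (X : qbfs mu).
Local Open Scope ereal_scope.

Definition normX (f : T -> \bar R) : \bar R :=
  ext_norm (qb_set X) (@qb_norm _ _ _ X) f.

Definition absolutely_continuous_qnorm :=
  forall (f : T -> \bar R) (E : nat -> set T), qb_set X f ->
    (forall k, mu.-caratheodory (E k)) -> (forall k, E k.+1 `<=` E k) ->
    \bigcap_k E k = set0 ->
    normX (f \_ (E k)) @[k --> \oo] --> 0.

(* Where u x = u y = +oo, the left-hand side is +oo, so the exceptional set has
   to absorb the null set where u is infinite. *)
Definition s_gradient (s : R) (u : T -> \bar R) : set (T -> \bar R) :=
  [set g | [/\ mu_measurable_fun mu g, forall x, 0 <= g x &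
    exists2 E : set T, mu E = 0 & forall x y, ~ E x -> ~ E y ->
      `|u x - u y| <= (mdist x y `^ s)%:E * (g x + g y)]].

Definition hom_hajlasz_norm (s : R) (u : T -> \bar R) : \bar R :=
  ereal_inf [set normX g | g in s_gradient s u].

Definition hom_hajlasz (s : R) : set (T -> \bar R) :=
  [set u | L0 mu u /\ hom_hajlasz_norm s u < +oo].

Definition hajlasz (s : R) : set (T -> \bar R) :=
  hom_hajlasz s `&` qb_set X.

Definition hajlasz_norm (s : R) (u : T -> \bar R) : \bar R :=
  normX u + hom_hajlasz_norm s u.

Definition capacity (s : R) (E : set T) : \bar R :=
  ereal_inf [set hajlasz_norm s u | u in
    [set u | hajlasz s u /\
      exists U : set T, [/\ open U, E `<=` U & forall x, U x -> 1 <= u x]]].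

Definition quasieverywhere (s : R) (P : T -> Prop) :=
  capacity s [set x | ~ P x] = 0.

Definition quasicontinuous (s : R) (u : T -> \bar R) :=
  forall e : R, (0 < e)%R -> exists2 E : set T,
    capacity s E < e%:E & {within ~` E, continuous u}.

End Hajlasz.

Section Medians.
Context {R : realType} {T : pmetricType R}.
Variable mu : {outer_measure set T -> \bar R}.
Local Open Scope ereal_scope.

Definition median (gamma : R) (u : T -> \bar R) (A : set T) : \bar R :=
  ereal_inf [set a%:E | a in
    [set a : R | mu (A `&` [set x | a%:E < u x]) < gamma%:E * mu A]].

Definition median_maximal (gamma : R) (u : T -> \bar R) (x : T) : \bar R :=
  ereal_sup [set median gamma (fun y => `|u y|) (ball x r) |
    r in [set r : R | (0 < r)%R]].

Definition Phi (X : qbfs mu) (gamma : R) : \bar R :=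
  ereal_sup [set normX X (median_maximal gamma f) |
    f in [set f | normX X f <= 1]].

Definition is_upper_boyd_index (X : qbfs mu) (alpha : \bar R) :=
  lne (Phi X gamma) / (ln gamma^-1)%:E @[gamma --> (0%R : R)^'+] --> alpha.

(* The average converges to u x in the extended reals; integrability on small
   balls makes sure that the averages are genuine integrals. *)
Definition lebesgue_point (u : T -> \bar R) (x : T) :=
  (\forall r \near (0%R : R)^'+, (cara_measure mu).-integrable (ball x r) u) /\
  (mu (ball x r))^-1 * \int[cara_measure mu]_(y in ball x r) u y
    @[r --> (0%R : R)^'+] --> u x.

Definition gen_lebesgue_point (u : T -> \bar R) (x : T) :=
  forall gamma : R, (0 < gamma < 1)%R ->
    median gamma (fun y => `|u y - u x|) (ball x r)
      @[r --> (0%R : R)^'+] --> 0 /\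
    median gamma u (ball x r) @[r --> (0%R : R)^'+] --> u x.

End Medians.

(* Main.v *)
Require Import Defs.
From mathcomp Require Import all_boot all_order all_algebra.
From mathcomp Require Import all_classical all_reals all_analysis.
From mathcomp Require Import measurable_realfun lra ring.
Import Order.TTheory GRing.Theory Num.Def Num.Theory.
Import numFieldNormedType.Exports.
Local Open Scope classical_set_scope.
Local Open Scope ring_scope.
Set Implicit Arguments.
Unset Strict Implicit.
Unset Printing Implicit Defensive.

(** Let [g] be an [s]-gradient of [u] lying in [X]. Both claims say that some
pointwise quantity built from [u] and [g] behaves well outside a set of capacity
zero; the proof first finds that exceptional set, and then works at one point.

_Test functions._ The main test functions for capacities are suprema of tents
[tent x r], one for each ball of a family ([capacity_tents]). A tent has slope of order [1 / r], hence [s]-gradient of order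
[r^-s] on its ball, so the supremum has a gradient in [X] as soon as [r^-s] is
dominated on each ball of the family by one function of [X]. That function is a
median maximal function: a median over [ball x r] is at most the maximal function,
with a smaller parameter, at every point of the ball ([median_le_maximal]), and
the Boyd index keeps maximal functions in [X], with [Phi X gam <= gam^-beta] for
small [gam] and any [beta] above the index ([Phi_le_power]).

_The gradient on small balls._ For [q] small and [t > beta] the series
[sum_i q^(i t) M^(kappa q^i) g] converges in [X], where [kappa] compares the
measures of [ball x r] and [ball z (2 r)] for [z] in [ball x r]. Using it in the tents shows that
[r^s sum_i q^(i t) median (q^i) g (ball x r)] tends to [0] for quasievery [x]: the
bounded part of [g] contributes [O (r^s)] and the unbounded part has small norm
because the norm is absolutely continuous ([median_series_vanishes]).

_Quasicontinuity._ [u] is continuous off a set [E] of small capacity, and [E] lies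
in an open set on which a test function [F] of small norm is at least [1]. The
balls at least half filled by that open set form a family as above: in such a ball
[F] is at least [1] at a point where its gradient is below the maximal function,
so wherever [F] is smaller than [1 / 2] nearby, its gradient and the maximal
function together exceed a multiple of [r^-s] ([capacity_half_filled]). So
quasievery [x] has the property [mostly_near]: in every small ball [u] is close to
[u x] on more than half of the ball. A truncation argument shows moreover that [u x]
is finite ([infinite_value_null]).

_Generalized Lebesgue points._ Fix [x] with both properties. In a small ball some
point [p] satisfies [u p ~ u x] and [g p <= a], where [a] is a median of [g]; every
other point with [g <= a], that is, all but a given fraction of the ball, then
satisfies [|u y - u p| <= C r^s a], which is small. This needs only some finite
[t > beta].

_Lebesgue points._ With [t = 1 + s / Q], possible because the index is below
[(Q + s) / Q], the mean of [|u - u p|] is controlled by chaining. Let [a_i] be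
medians of [g] with parameter [q^(i+1)]. By the lower mass bound, a point with
[g <= a_(j+1)] has within distance of order [r q^(j/Q)] a point with [g <= a_j], so
[u] changes by at most [C r^s q^(j s/Q) a_(j+1)] in that step. The set where step
[j] is needed has relative measure at most [q^(j+1)], and summation gives
[C r^s sum_i q^(i (1 + s/Q)) a_i], which tends to [0] ([chain_integral],
[oscillation_le]). *)

(** * Null sets of the outer measure *)

Section NullSets.
Context {R : realType} {T : pmetricType R}.
Context {mu : {outer_measure set T -> \bar R}}.
Implicit Types A B N : set T.

Lemma outer_null_sub A N : mu N = 0%E -> A `<=` N -> mu A = 0%E.
Proof.
move=> N0 AN; apply/eqP; rewrite eq_le outer_measure_ge0 andbT -N0.
exact: le_outer_measure.
Qed.

Lemma outer_nullU A B : mu A = 0%E -> mu B = 0%E -> mu (A `|` B) = 0%E.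
Proof.
move=> A0 B0; apply/eqP; rewrite eq_le outer_measure_ge0 andbT.
by rewrite (le_trans (outer_measureU2 mu A B))// A0 B0 adde0.
Qed.

Lemma outer_null_bigcup (A : nat -> set T) :
  (forall n, mu (A n) = 0%E) -> mu (\bigcup_n A n) = 0%E.
Proof.
move=> A0; apply/eqP; rewrite eq_le outer_measure_ge0 andbT.
rewrite (le_trans (outer_measure_sigma_subadditive mu A))//.
by rewrite eseries0.
Qed.

Lemma caratheodory_null N : mu N = 0%E -> mu.-caratheodory N.
Proof.
move=> N0; apply: le_caratheodory_measurable => S.
rewrite (@outer_null_sub (S `&` N) N N0) ?add0e; last by move=> ? [].
by apply: le_outer_measure => ? [].
Qed.

Lemma ae_off_null (P : T -> Prop) N : mu N = 0%E ->
  (forall x, ~ N x -> P x) -> {ae cara_measure mu, forall x, P x}.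
Proof.
move=> N0 NP; exists N; split => //; first exact: caratheodory_null.
by move=> x /=; apply: contra_notP => /NP.
Qed.

Lemma null_of_ae (P : T -> Prop) :
  {ae cara_measure mu, forall x, P x} -> mu [set x | ~ P x] = 0%E.
Proof. by move=> [A [mA A0 PA]]; exact: outer_null_sub A0 PA. Qed.

End NullSets.

(** * Quasi-Banach function spaces *)

Section Qnorm.
Context {R : realType} {T : pmetricType R}.
Context {mu : {outer_measure set T -> \bar R}} (X : qbfs mu).
Local Open Scope ereal_scope.

Lemma qb_measurable f : qb_set X f -> mu_measurable_fun mu f.
Proof. by move/(@qb_L0 _ _ _ X) => []. Qed.

Lemma qb_fin f : qb_set X f -> mu [set x | f x \isn't a fin_num] = 0.
Proof.
move/(@qb_L0 _ _ _ X) => [_] /null_of_ae N0; apply: (outer_null_sub N0) => x /=.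
by move/negP.
Qed.

Lemma normXE f : qb_set X f -> normX X f = (qb_norm X f)%:E.
Proof. by move=> Xf; rewrite /normX /ext_norm mem_set. Qed.

Lemma normX_ltP f (t : R) : normX X f < t%:E <-> qb_set X f /\ (qb_norm X f < t)%R.
Proof.
rewrite /normX /ext_norm; case: ifPn => [|nXf]; first by rewrite inE lte_fin; split=> // -[].
by split => // -[Xf _]; rewrite mem_set in nXf.
Qed.

Lemma normX_leP f (t : R) : normX X f <= t%:E <-> qb_set X f /\ (qb_norm X f <= t)%R.
Proof.
rewrite /normX /ext_norm; case: ifPn => [|nXf]; first by rewrite inE lee_fin; split=> // -[].
by split => // -[Xf _]; rewrite mem_set in nXf.
Qed.

Lemma normX_ge0 f : 0 <= normX X f.
Proof.
rewrite /normX /ext_norm; case: ifPn => // /set_mem Xf.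
by rewrite lee_fin qb_norm_ge0.
Qed.

Lemma qb_le N f g : mu N = 0 -> mu_measurable_fun mu f -> qb_set X g ->
  (forall x, ~ N x -> `|f x| <= `|g x|) ->
  qb_set X f /\ (qb_norm X f <= qb_norm X g)%R.
Proof. by move=> N0 mf Xg fg; apply: qb_lattice => //; exact: ae_off_null fg. Qed.

Lemma qb_qtriangle : exists2 c : R, (1 <= c)%R & forall f g,
  qb_set X f -> qb_set X g ->
  (qb_norm X (fun x => f x + g x) <= c * (qb_norm X f + qb_norm X g))%R.
Proof.
have [c qtriangle] := qb_normD X; exists (maxr 1 c)%R; first by rewrite le_max lexx.
move=> f g Xf Xg; apply: (le_trans (qtriangle _ _ Xf Xg)).
by rewrite ler_wpM2r ?addr_ge0 ?qb_norm_ge0// le_max lexx orbT.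
Qed.

Lemma qb_fine f : qb_set X f ->
  qb_set X (EFin \o fine \o f) /\ (qb_norm X (EFin \o fine \o f) <= qb_norm X f)%R.
Proof.
move=> Xf; apply: (qb_le (qb_fin Xf)) => //.
  apply/measurable_EFinP; apply: measurableT_comp; first exact: fine_measurable.
  exact: qb_measurable.
by move=> x /negP; rewrite negbK => fx /=; rewrite -{2}(fineK fx).
Qed.

Lemma qb_abse f : qb_set X f -> qb_set X (abse \o f) /\
  (qb_norm X (abse \o f) <= qb_norm X f)%R.
Proof.
move=> Xf; apply: (@qb_le set0) => //.
  by apply: measurableT_comp => //; exact: qb_measurable.
by move=> x _; rewrite abse_id.
Qed.

Lemma qb_scaleP (a : R) f : (0 <= a)%R -> qb_set X f ->
  qb_set X (fun x => a%:E * f x) /\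
  qb_norm X (fun x => a%:E * f x)%E = (a * qb_norm X f)%R.
Proof.
by move=> a0 Xf; split; [exact: qb_scale|rewrite qb_normZ// ger0_norm].
Qed.

Section Series.
Context (c : R).
Hypothesis c1 : (1 <= c)%R.
Hypothesis qtriangle : forall f g, qb_set X f -> qb_set X g ->
  (qb_norm X (fun x => f x + g x) <= c * (qb_norm X f + qb_norm X g))%R.

(** Peeling off one term costs a factor [c] on everything that remains, so the
[i]-th term has to be discounted by [c ^ i]; the extra power of [2] is what makes
the bound independent of [n]. *)
Lemma qb_sum n (f : nat -> T -> \bar R) (A : R) :
  (forall i, qb_set X (f i)) ->
  (forall i, qb_norm X (f i) <= A / (2 * c) ^+ i.+1)%R ->
  qb_set X (fun x => \sum_(i < n) f i x) /\
  (qb_norm X (fun x => \sum_(i < n) f i x)%E <= A)%R.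
Proof.
have c0 : (0 < 2 * c)%R by rewrite mulr_gt0// (lt_le_trans ltr01).
elim: n f A => [|n IH] f A Xf fA.
  have -> : (fun x => \sum_(i < 0) f i x) = cst 0 by apply/funext => x; rewrite big_ord0.
  split; first exact: qb_zero.
  have -> : qb_norm X (cst 0) = 0%R.
    apply/qb_norm_eq0; first exact: qb_zero.
    by apply: (@ae_off_null _ _ _ _ set0) => //; exact: (outer_measure0 mu).
  have := le_trans (qb_norm_ge0 (Xf 0%N)) (fA 0%N).
  by rewrite pmulr_lge0// invr_gt0 exprn_gt0.
have [Xr Nr] : qb_set X (fun x => \sum_(i < n) f i.+1 x) /\
    (qb_norm X (fun x => \sum_(i < n) f i.+1 x)%E <= A / (2 * c))%R.
  apply: (IH (fun i => f i.+1)) => // i.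
  by rewrite -mulrA -invfM -exprS; exact: fA.
have -> : (fun x => \sum_(i < n.+1) f i x) = (fun x => f 0%N x + \sum_(i < n) f i.+1 x).
  by apply/funext => x; rewrite big_ord_recl.
split; first exact: qb_add.
apply: (le_trans (qtriangle (Xf 0%N) Xr)).
have := fA 0%N; rewrite expr1 => f0A.
apply: (@le_trans _ _ (c * (A / (2 * c) + A / (2 * c)))%R).
  by rewrite ler_wpM2l ?lerD// (le_trans ler01).
have -> : (c * (A / (2 * c) + A / (2 * c)) = A)%R.
  by field; rewrite gt_eqF// (lt_le_trans ltr01).
exact: lexx.
Qed.

(** The partial sums increase to the series, so the Fatou property carries the
bound of [qb_sum] over to the limit, and membership in [X] with it. *)
Lemma qb_series (f : nat -> T -> \bar R) (A : R) :
  (forall i, qb_set X (f i)) -> (forall i x, 0 <= f i x) ->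
  (forall i, qb_norm X (f i) <= A / (2 * c) ^+ i.+1)%R ->
  qb_set X (fun x => \sum_(i <oo) f i x) /\
  (qb_norm X (fun x => \sum_(i <oo) f i x)%E <= A)%R.
Proof.
move=> Xf f0 fA; apply/normX_leP.
pose S n x := \sum_(i < n) f i x.
have cvgS x : S n x @[n --> \oo] --> \sum_(i <oo) f i x.
  rewrite /S; under eq_fun do rewrite -(big_mkord xpredT (f ^~ x)).
  by apply: is_cvg_nneseries => *; exact: f0.
have XS n : qb_set X (S n) by have [] := qb_sum n Xf fA.
have [] := @qb_fatou _ _ _ X S (fun x => \sum_(i <oo) f i x).
- by move=> n; exact: qb_measurable.
- apply: (@emeasurable_fun_cvg _ (caratheodory_type mu) R setT S) => // n.
  exact: qb_measurable.
- apply: (@ae_off_null _ _ _ _ set0); first exact: (outer_measure0 mu).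
  move=> x _; split => // n; first by rewrite /S sume_ge0.
  by rewrite /S big_ord_recr leeDl.
move=> _ cvgN; rewrite /normX -(cvg_lim _ cvgN)//.
apply: lime_le; first by apply/cvg_ex; eexists; exact: cvgN.
apply: nearW => n; apply/(normX_leP (S n)).
by have [] := qb_sum n Xf fA.
Qed.

End Series.

End Qnorm.

(** * Capacity *)

Section Capacity.
Context {R : realType} {T : pmetricType R}.
Context {mu : {outer_measure set T -> \bar R}} (X : qbfs mu) (s : R).
Local Open Scope ereal_scope.

Lemma abse_sub_le (a b : R) (w : \bar R) :
  a%:E <= b%:E + w -> b%:E <= a%:E + w -> `|a%:E - b%:E| <= w.
Proof.
move=> ab ba; rewrite -EFinB abse_EFin; have [le_ab|lt_ba] := leP a b.
  by rewrite distrC ger0_norm ?subr_ge0// EFinB leeBlDl.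
by rewrite ger0_norm ?subr_ge0 ?(ltW lt_ba)// EFinB leeBlDl.
Qed.

(** The gradient inequality is only asked for where [F] is finite: the infinite
values of an element of [X] form a null set, which joins the exceptional set. *)
Lemma capacity_le (F H : T -> \bar R) (N U E : set T) :
  qb_set X F -> qb_set X H -> (forall x, 0 <= H x) -> mu N = 0 ->
  (forall x y, ~ N x -> ~ N y -> F x \is a fin_num -> F y \is a fin_num ->
    F x <= F y + (mdist x y `^ s)%:E * (H x + H y)) ->
  open U -> E `<=` U -> (forall x, U x -> 1 <= F x) ->
  capacity X s E <= (qb_norm X F + qb_norm X H)%:E.
Proof.
move=> XF XH H0 N0 grad oU EU F1.
have gradH : s_gradient mu s F H.
  split => //; first exact: (qb_measurable XH).
  exists (N `|` [set x | F x \isn't a fin_num]).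
    by apply: outer_nullU => //; exact: (qb_fin XF).
  move=> x y /not_orP[Nx /negP/negPn Fx] /not_orP[Ny /negP/negPn Fy].
  have := grad _ _ Nx Ny Fx Fy; have := grad _ _ Ny Nx Fy Fx.
  rewrite (metric_sym y x) (addeC (H y)) -(fineK Fx) -(fineK Fy) => *.
  exact: abse_sub_le.
have homF : hom_hajlasz_norm X s F <= (qb_norm X H)%:E.
  by rewrite -normXE//; apply: ereal_inf_lbound; exists H.
apply: (@le_trans _ _ (hajlasz_norm X s F)).
  apply: ereal_inf_lbound; exists F => //; split; last by exists U.
  split => //; split; first exact: (qb_L0 XF).
  by rewrite (le_lt_trans homF)// ltry.
by rewrite /hajlasz_norm normXE// EFinD leeD2l.
Qed.

(** Converse of [capacity_le], with every null set on which something is infinite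
collected in [N], so that off [N] all quantities are real. *)
Lemma capacity_witness E (e : R) : capacity X s E < e%:E ->
  exists F H : T -> \bar R, exists N U : set T,
  [/\ qb_set X F, qb_set X H, forall x, 0 <= H x &
      (qb_norm X F < e)%R /\ (qb_norm X H < e)%R] /\
  [/\ mu N = 0, forall x, ~ N x -> F x \is a fin_num /\ H x \is a fin_num,
      forall x y, ~ N x -> ~ N y ->
       `|F x - F y| <= (mdist x y `^ s)%:E * (H x + H y) &
      [/\ open U, E `<=` U & forall x, U x -> 1 <= F x]].
Proof.
move/ereal_inf_lt => [_ [F [[[_ hF] XF] [U [oU EU F1]]] <-]] Fe.
have [_ [H [mH H0 [N0 N00 grad]] <-]] : exists2 r,
    [set normX X g | g in s_gradient mu s F] r & r < e%:E - normX X F.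
  by apply: ereal_inf_lt; rewrite normXE// lteBrDl// -normXE.
rewrite (normXE XF)// -EFinB => /normX_ltP[XH He].
exists F, H, (N0 `|` ([set x | F x \isn't a fin_num] `|` [set x | H x \isn't a fin_num])), U.
have NF := qb_norm_ge0 XF; have NH := qb_norm_ge0 XH.
split; first by split => //; split; lra.
split => //.
- by apply: outer_nullU => //; apply: outer_nullU; [exact: (qb_fin XF)|exact: (qb_fin XH)].
- by move=> x /not_orP[_ /not_orP[/negP/negPn ? /negP/negPn ?]].
- by move=> x y /not_orP[? _] /not_orP[? _]; exact: grad.
Qed.

Lemma capacity_ge0 E : 0 <= capacity X s E.
Proof.
apply: le_ereal_inf_tmp => _ [F [_ _] <-]; rewrite adde_ge0 ?normX_ge0//.
by apply: le_ereal_inf_tmp => _ [H _ <-]; exact: normX_ge0.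
Qed.

Definition cap_null E := capacity X s E = 0.

Lemma cap_nullP E : cap_null E <-> forall e : R, (0 < e)%R -> capacity X s E <= e%:E.
Proof.
split=> [-> e e0|Ee]; first by rewrite lee_fin ltW.
apply/eqP; rewrite eq_le capacity_ge0 andbT.
by apply/lee_addgt0Pr => e e0; rewrite add0e Ee.
Qed.

Lemma capacity_sub A B : A `<=` B -> capacity X s A <= capacity X s B.
Proof.
move=> AB; apply: ereal_inf_le_tmp => _ [F [hF [U [oU BU F1]]] <-].
by exists F => //; split => //; exists U; split => //; exact: subset_trans BU.
Qed.

Lemma cap_null_sub A B : A `<=` B -> cap_null B -> cap_null A.
Proof.
move=> AB B0; apply/cap_nullP => e e0.
by rewrite (le_trans (capacity_sub AB))// B0 lee_fin ltW.
Qed.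

(** The sum of the absolute values of test functions with rapidly decreasing norms
is a test function for the union: its gradient is the sum of the gradients, and it
is at least [1] wherever one of the terms is. A sum is preferable to a supremum
since [qb_series] provides its measurability. *)
Lemma cap_null_bigcup (E : nat -> set T) :
  (forall n, cap_null (E n)) -> cap_null (\bigcup_n E n).
Proof.
move=> E0; apply/cap_nullP => e e0.
have [c c1 qtriangle] := qb_qtriangle X.
have c0 : (0 < 2 * c)%R by rewrite mulr_gt0// (lt_le_trans ltr01).
pose A := (e / 2)%R; have A0 : (0 < A)%R by rewrite divr_gt0.
have /choice[F /choice[H /choice[N /choice[U W]]]] n : exists F H : T -> \bar R, exists N U : set T,
    [/\ qb_set X F, qb_set X H, forall x, 0 <= H x &
      (qb_norm X F < A / (2 * c) ^+ n.+1)%R /\ (qb_norm X H < A / (2 * c) ^+ n.+1)%R] /\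
    [/\ mu N = 0, forall x, ~ N x -> F x \is a fin_num /\ H x \is a fin_num,
      forall x y, ~ N x -> ~ N y ->
       `|F x - F y| <= (mdist x y `^ s)%:E * (H x + H y) &
      [/\ open U, E n `<=` U & forall x, U x -> 1 <= F x]].
  by apply: capacity_witness; rewrite E0 lte_fin divr_gt0// exprn_gt0.
have [XF NF] : qb_set X (fun x => \sum_(i <oo) `|F i x|) /\
    (qb_norm X (fun x => \sum_(i <oo) `|F i x|)%E <= A)%R.
  apply: (qb_series c1 qtriangle) => [i|i x|i].
  - by have [[XF _ _ _] _] := W i; have [] := qb_abse XF.
  - exact: abse_ge0.
  - have [[XF _ _ [NF _]] _] := W i; have [_ NF'] := qb_abse XF.
    exact: (le_trans NF' (ltW NF)).
have [XH NH] : qb_set X (fun x => \sum_(i <oo) H i x) /\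
    (qb_norm X (fun x => \sum_(i <oo) H i x)%E <= A)%R.
  apply: (qb_series c1 qtriangle) => [i|i x|i].
  - by have [[]] := W i.
  - by have [[]] := W i.
  - by have [[_ _ _ [_ /ltW]]] := W i.
have -> : e = (A + A)%R by rewrite /A; field.
apply: (@le_trans _ _ (qb_norm X (fun x => \sum_(i <oo) `|F i x|)%E +
    qb_norm X (fun x => \sum_(i <oo) H i x)%E)%:E); last first.
  by rewrite lee_fin lerD.
have H0 i x : 0 <= H i x by have [[]] := W i.
apply: (@capacity_le _ _ (\bigcup_n N n) (\bigcup_n U n)) => //.
- by move=> x; apply: nneseries_ge0.
- by apply: outer_null_bigcup => n; have [_ []] := W n.
- move=> x y Nx Ny _ _.
  rewrite -nneseriesD// -nneseriesZl; last by move=> i _; rewrite adde_ge0.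
  rewrite -nneseriesD//; last by move=> i _ _; rewrite mule_ge0 ?adde_ge0// lee_fin powR_ge0.
  apply: lee_nneseries => // n _.
  have [_ [_ fN + _]] := W n.
  have {}Nx : ~ N n x by move=> ?; apply: Nx; exists n.
  have {}Ny : ~ N n y by move=> ?; apply: Ny; exists n.
  move=> /(_ _ _ Nx Ny).
  have [/fineK <- _] := fN _ Nx; have [/fineK <- _] := fN _ Ny.
  rewrite -EFinB !abse_EFin => le1.
  apply: (le_trans _ (leeD2l _ le1)); rewrite lee_fin.
  by rewrite -lerBlDl lerB_dist.
- by apply: bigcup_open => n _; have [_ [_ _ _ []]] := W n.
- by move=> x [n _ Enx]; exists n => //; have [_ [_ _ _ [_ + _]]] := W n; exact.
- move=> x [n _ Unx].
  have Fn1 : 1 <= `|F n x|.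
    have [_ [_ _ _ [_ _ /(_ _ Unx) F1]]] := W n.
    by rewrite (le_trans F1)// lee_abs.
  rewrite (le_trans Fn1)//.
  have := @nneseries_lim_ge _ (fun i => `|F i x|) xpredT 0 n.+1.
  move=> /(_ (fun _ _ _ => abse_ge0 _)); apply: le_trans.
  by rewrite big_nat_recr//= leeDr// sume_ge0.
Qed.

Lemma cap_nullU A B : cap_null A -> cap_null B -> cap_null (A `|` B).
Proof.
move=> A0 B0; apply: (@cap_null_sub _ (\bigcup_n (if n is 0%N then A else B))).
  by move=> x [Ax|Bx]; [exists 0%N|exists 1%N].
by apply: cap_null_bigcup => -[|n].
Qed.

End Capacity.

(** * Suprema of tents as capacity test functions *)

Section Tents.
Context {R : realType} {T : pmetricType R}.
Implicit Types (x y z : T) (r a : R) (S : T -> R -> Prop).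

Lemma open_mball x r : open (ball x r).
Proof.
rewrite openE => y; rewrite ballEmdist/= => xy.
apply/nbhs_ballP; exists (r - mdist x y) => /=; first by rewrite subr_gt0.
move=> z; rewrite !ballEmdist/= => yz.
by rewrite (le_lt_trans (metric_triangle x y z))// addrC -ltrBrDr.
Qed.

(** The height [2] makes the tent at least [1] on the ball of radius [r / 2], which
is a neighbourhood of the centre. *)
Definition tent x r z : R := maxr 0 (2 * (1 - mdist x z / r)).

Lemma tent_ge0 x r z : 0 <= tent x r z.
Proof. by rewrite /tent le_max lexx. Qed.

Lemma tent_le2 x r z : 0 < r -> tent x r z <= 2.
Proof.
move=> r0; rewrite /tent ge_max; apply/andP; split => //.
by rewrite ler_piMr// gerBl divr_ge0 ?mdist_ge0 ?(ltW r0).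
Qed.

Lemma lt_tent x r z a : 0 < r -> 0 <= a ->
  (a < tent x r z) = (mdist x z < r * (1 - a / 2)).
Proof.
move=> r0 a0; rewrite /tent lt_max ltNge a0/=.
have -> : (a < 2 * (1 - mdist x z / r)) = (mdist x z / r < 1 - a / 2).
  by apply/idP/idP; lra.
by rewrite ltr_pdivrMr// mulrC.
Qed.

Lemma tent_gt0 x r z : 0 < r -> 0 < tent x r z -> mdist x z < r.
Proof. by move=> r0; rewrite lt_tent// mul0r subr0 mulr1. Qed.

Lemma tent_ge1 x r z : 0 < r -> mdist x z < r / 2 -> 1 <= tent x r z.
Proof.
by move=> r0 xz; apply: ltW; rewrite lt_tent//; apply: (lt_le_trans xz); lra.
Qed.

(** A tent is [2 / r]-Lipschitz and bounded by [2]; as [s <= 1], one of the two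
bounds gives the Holder estimate according to whether the points are closer than
[r]. *)
Lemma tent_holder (s : R) x r z y : 0 < s -> s <= 1 -> 0 < r ->
  tent x r z - tent x r y <= 2 * (mdist z y / r) `^ s.
Proof.
move=> s0 s1 r0; have d0 : 0 <= mdist z y / r by rewrite divr_ge0 ?mdist_ge0 ?(ltW r0).
have [d1|d1] := leP 1 (mdist z y / r).
  apply: (@le_trans _ _ 2); first by have := tent_le2 x z r0; have := tent_ge0 x r y; lra.
  have p1 : 1 `^ s = 1 :> R by rewrite powR1.
  rewrite ler_peMr// -p1; apply: ge0_ler_powR; rewrite ?nnegrE//; exact: ltW.
apply: (@le_trans _ _ (2 * (mdist z y / r))); last first.
  rewrite ler_pM2l//; have [->|dn0] := eqVneq (mdist z y / r) 0.
    by rewrite powR0// gt_eqF.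
  by rewrite ger1_powR// (ltW d1) andbT lt_neqAle eq_sym dn0 d0.
have tri : mdist x y / r <= mdist x z / r + mdist z y / r.
  by rewrite -mulrDl ler_pM2r ?invr_gt0//; exact: metric_triangle.
rewrite /tent; set A := mdist x z / r in tri *; set B := mdist x y / r in tri *.
have B0 : 0 <= maxr 0 (2 * (1 - B)) :> R by rewrite le_max lexx.
have B1 : 2 * (1 - B) <= maxr 0 (2 * (1 - B)) by rewrite le_max lexx orbT.
by rewrite lerBlDr ge_max; apply/andP; split; lra.
Qed.

Definition tents S z : R := sup [set v | v = 0 \/ exists x r, S x r /\ v = tent x r z].

Context (S : T -> R -> Prop).
Hypothesis S0 : forall x r, S x r -> 0 < r.

Let has_sup_tents z : has_sup [set v | v = 0 \/ exists x r, S x r /\ v = tent x r z].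
Proof.
split; first by exists 0; left.
exists 2 => v [->//|[x [r [Sxr ->]]]]; apply: tent_le2; exact: S0 Sxr.
Qed.

Lemma tents_ge0 z : 0 <= tents S z.
Proof. by apply: sup_ubound; [case: (has_sup_tents z)|left]. Qed.

Lemma tents_le2 z : tents S z <= 2.
Proof.
apply: ge_sup => [|v [->//|[x [r [Sxr ->]]]]]; first by exists 0; left.
by apply: tent_le2; exact: S0 Sxr.
Qed.

Lemma tents_ge x r z : S x r -> tent x r z <= tents S z.
Proof.
move=> Sxr; apply: sup_ubound; first by case: (has_sup_tents z).
by right; exists x, r.
Qed.

Lemma lt_tents a z : 0 <= a -> a < tents S z ->
  exists x r, S x r /\ a < tent x r z.
Proof.
move=> a0 az; have e0 : 0 < tents S z - a by rewrite subr_gt0.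
have [v vS] := sup_adherent e0 (has_sup_tents z).
rewrite subKr => av; case: vS => [v0|[x [r [Sxr vE]]]].
  by move: av; rewrite v0 ltNge a0.
by exists x, r; rewrite -vE.
Qed.

(** Lower semicontinuity: the supremum exceeds [a] exactly on a union of balls.
This is why uncountably many tents still have a measurable supremum. *)
Lemma open_lt_tents a : open [set z | a < tents S z].
Proof.
have [a0|a0] := leP 0 a; last first.
  rewrite (_ : [set z | _] = setT); first exact: openT.
  by apply/seteqP; split => // z _ /=; rewrite (lt_le_trans a0)// tents_ge0.
rewrite (_ : [set z | _] =
    \bigcup_(p in [set p | S p.1 p.2]) ball p.1 (p.2 * (1 - a / 2))).
  by apply: bigcup_open => p _; apply: open_mball.
apply/seteqP; split => [z /=|z [[x r] /= Sxr]].
  move=> /(lt_tents a0)[x [r [Sxr atz]]]; exists (x, r) => //=.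
  by rewrite ballEmdist/= -lt_tent//; exact: S0 Sxr.
rewrite ballEmdist/= -lt_tent//; last exact: S0 Sxr.
by move=> /lt_le_trans; apply; exact: tents_ge.
Qed.

End Tents.

Section CapacityTents.
Context {R : realType} {T : pmetricType R}.
Context {mu : {outer_measure set T -> \bar R}} (X : qbfs mu) (s : R).
Hypothesis open_cara : forall U : set T, open U -> mu.-caratheodory U.

Lemma measurable_tents (S : T -> R -> Prop) : (forall x r, S x r -> 0 < r) ->
  measurable_fun [set: caratheodory_type mu] (tents S).
Proof.
move=> S0 _; apply: (measurability _ (RGenOInfty.measurableE R)) => //.
move=> _ [_ [a ->] <-]; rewrite setTI.
rewrite (_ : _ @^-1` _ = [set z | a < tents S z]).
  exact/open_cara/open_lt_tents.
by apply/seteqP; split => z; rewrite /= in_itv/= andbT.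
Qed.

(** The test function is [max F (tents S)]. The tent condition only concerns pairs
where [F y] is below the tent at [z], since otherwise [F y] itself bounds the
tent: this is what lets [F] make up for tents whose slope is too large. With
[F = 0] the lemma treats tents whose slope is bounded by [H] outright. *)
Lemma capacity_tents (S : T -> R -> Prop) (F G H : T -> R) (N : set T) :
  (forall x r, S x r -> 0 < r) ->
  measurable_fun [set: caratheodory_type mu] F ->
  qb_set X (EFin \o G) -> qb_set X (EFin \o H) ->
  (forall x, 0 <= G x) -> (forall x, 0 <= H x) -> mu N = 0%E ->
  (forall z, ~ N z -> `|F z| <= G z) ->
  (forall z y, ~ N z -> ~ N y ->
     F z <= F y + mdist z y `^ s * (H z + H y)) ->
  (forall x r z, S x r -> ~ N z -> mdist x z < r -> 2 <= G z) ->
  (forall x r z y, S x r -> ~ N z -> ~ N y -> mdist x z < r ->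
     F y < tent x r z ->
     tent x r z <= Num.max (F y) (tent x r y) + mdist z y `^ s * (H z + H y)) ->
  (capacity X s [set x | exists r, S x r] <=
   (qb_norm X (EFin \o G) + qb_norm X (EFin \o H))%:E)%E.
Proof.
move=> S0 mF XG XH G0 H0 N0 FG gradF SG gradS.
pose F' z := Num.max (F z) (tents S z).
have F'F z : F z <= F' z by rewrite le_max lexx.
have F'S z : tents S z <= F' z by rewrite le_max lexx orbT.
have D0 z y : 0 <= mdist z y `^ s * (H z + H y).
  by rewrite mulr_ge0 ?powR_ge0 ?addr_ge0.
have gradF' z y : ~ N z -> ~ N y -> F' z <= F' y + mdist z y `^ s * (H z + H y).
  move=> Nz Ny; rewrite [F' z]/F' ge_max; apply/andP; split.
    by rewrite (le_trans (gradF _ _ Nz Ny))// lerD2r.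
  rewrite leNgt; apply/negP => lt1.
  have a0 : 0 <= F' y + mdist z y `^ s * (H z + H y).
    by rewrite addr_ge0// (le_trans _ (F'S y))//; exact: tents_ge0.
  have [x [r [Sxr lt2]]] := lt_tents S0 a0 lt1.
  have r0 := S0 _ _ Sxr.
  have xz : mdist x z < r by apply: (tent_gt0 r0); exact: le_lt_trans lt2.
  have Fyz : F y < tent x r z.
    by apply: le_lt_trans lt2; rewrite (le_trans (F'F y))// lerDl.
  have := gradS _ _ _ _ Sxr Nz Ny xz Fyz.
  rewrite leNgt => /negP; apply; apply: le_lt_trans lt2.
  rewrite lerD2r ge_max F'F/=; apply: le_trans (F'S y).
  exact: tents_ge.
have F'G z : ~ N z -> `|F' z| <= G z.
  move=> Nz; rewrite /F'; case: (leP (F z) (tents S z)) => [_|_]; last exact: FG.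
  rewrite ger0_norm ?tents_ge0//.
  have [le0|gt0] := leP (tents S z) 0; first exact: le_trans (G0 z).
  have [x [r [Sxr lt2]]] := lt_tents S0 (lexx 0) gt0.
  rewrite (le_trans (tents_le2 S0 z))// (SG x r)//.
  by apply: tent_gt0 => //; exact: S0 Sxr.
have mF' : measurable_fun [set: caratheodory_type mu] F'.
  by apply: measurable_maxr => //; exact: measurable_tents.
have [XF' NF'] : qb_set X (EFin \o F') /\
    qb_norm X (EFin \o F') <= qb_norm X (EFin \o G).
  apply: (qb_le N0) => //; first exact/measurable_EFinP.
  by move=> z Nz /=; rewrite lee_fin (le_trans (F'G _ Nz))// ler_norm.
apply: (@le_trans _ _ (qb_norm X (EFin \o F') + qb_norm X (EFin \o H))%:E); last first.
  by rewrite lee_fin lerD2r.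
apply: (@capacity_le _ _ _ _ _ _ _ N
  (\bigcup_(p in [set p | S p.1 p.2]) ball p.1 (p.2 / 2))) => //.
- by move=> z y Nz Ny _ _; have := gradF' z y Nz Ny; rewrite -lee_fin.
- by apply: bigcup_open => p _; exact: open_mball.
- move=> x [r Sxr]; exists (x, r) => //=.
  by rewrite ballEmdist/= mdistxx divr_gt0//; exact: S0 Sxr.
- move=> z [[x r] /= Sxr]; rewrite ballEmdist/= lee_fin => xz.
  apply: le_trans (F'S z); apply: le_trans (tents_ge S0 z Sxr).
  by apply: tent_ge1 => //; exact: S0 Sxr.
Qed.

End CapacityTents.

(** * Medians and the median maximal function *)

Section Medians.
Context {R : realType} {T : pmetricType R}.
Context {mu : {outer_measure set T -> \bar R}}.
Local Open Scope ereal_scope.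
Implicit Types (f g : T -> \bar R) (A : set T) (gam : R).

Lemma lt_median gam f A (a : R) : median mu gam f A < a%:E ->
  mu (A `&` [set x | a%:E < f x]) < gam%:E * mu A.
Proof.
move=> /ereal_inf_lt[_ [b bP <-] ba]; apply: le_lt_trans bP.
by apply: le_outer_measure => x [Ax /= afx]; split => //=; exact: lt_trans afx.
Qed.

Lemma median_le gam f A (a : R) :
  mu (A `&` [set x | a%:E < f x]) < gam%:E * mu A -> median mu gam f A <= a%:E.
Proof. by move=> aP; apply: ereal_inf_lbound; exists a. Qed.

Lemma le_median gam f A b :
  (forall a : R, mu (A `&` [set x | a%:E < f x]) < gam%:E * mu A -> b <= a%:E) ->
  b <= median mu gam f A.
Proof. by move=> bP; apply: le_ereal_inf_tmp => _ [a aP <-]; exact: bP. Qed.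

Lemma median_scale_le gam f A (t : R) : (0 < t)%R ->
  median mu gam (fun x => t%:E * f x) A <= t%:E * median mu gam f A.
Proof.
move=> t0; rewrite -lee_pdivrMl//; apply: le_median => a aP.
rewrite lee_pdivrMl// -EFinM; apply: median_le; apply: le_lt_trans aP.
by apply: le_outer_measure => x [Ax /=]; rewrite EFinM lte_pmul2l.
Qed.

Lemma scale_inv (t : R) f : (0 < t)%R -> (fun x => (t^-1)%:E * (t%:E * f x)) = f.
Proof.
move=> t0; apply/funext => x.
by rewrite muleA -EFinM mulVf ?mul1e// gt_eqF.
Qed.

Lemma median_scale gam f A (t : R) : (0 < t)%R ->
  median mu gam (fun x => t%:E * f x) A = t%:E * median mu gam f A.
Proof.
move=> t0; apply/eqP; rewrite eq_le median_scale_le//=.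
have ti0 : (0 < t^-1)%R by rewrite invr_gt0.
have := @median_scale_le gam (fun x => t%:E * f x) A _ ti0.
by rewrite scale_inv// -lee_pdivlMl// invrK.
Qed.

Lemma median_maximal_scale gam f (t : R) : (0 < t)%R ->
  median_maximal mu gam (fun x => t%:E * f x) =
  (fun x => t%:E * median_maximal mu gam f x).
Proof.
suff H g u : (0 < u)%R -> forall x, median_maximal mu gam (fun x => u%:E * g x) x <=
    u%:E * median_maximal mu gam g x.
  move=> t0; apply/funext => x; apply/eqP; rewrite eq_le H//=.
  have ti0 : (0 < t^-1)%R by rewrite invr_gt0.
  have := @H (fun x => t%:E * f x) _ ti0 x.
  by rewrite scale_inv// -lee_pdivlMl// invrK.
move=> u0 x; apply: ge_ereal_sup => _ [r /= r0 <-].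
have -> : (fun y => `|u%:E * g y|) = (fun y => u%:E * `|g y|).
  by apply/funext => y; rewrite abseM abse_EFin gtr0_norm.
rewrite median_scale// lee_pmul2l//.
by apply: ereal_sup_ubound; exists r.
Qed.

Hypothesis ball_pos : balls_pos_finite mu.

Lemma ball_not_lt x r gam : (0 < r)%R -> (gam <= 1)%R ->
  ~ mu (ball x r) < gam%:E * mu (ball x r).
Proof.
move=> r0 g1; apply/negP; rewrite -leNgt.
have /andP[m0 moo] := ball_pos x r0.
by rewrite -[leRHS]mul1e lee_wpmul2r ?lee_fin// ltW.
Qed.

Lemma median_ge0 gam f x r : (0 < r)%R -> (gam <= 1)%R -> (forall y, 0 <= f y) ->
  0 <= median mu gam f (ball x r).
Proof.
move=> r0 g1 f0; apply: le_median => a; apply: contraPT; rewrite -ltNge => a0.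
rewrite (_ : _ `&` _ = ball x r); first exact: ball_not_lt.
by apply/seteqP; split => [y []//|y xy]; split => //=; exact: lt_le_trans (f0 y).
Qed.

Lemma median_maximal_ge0 gam f x : (gam <= 1)%R -> 0 <= median_maximal mu gam f x.
Proof.
move=> g1; apply: (@le_trans _ _ (median mu gam (fun y => `|f y|) (ball x 1))).
  by apply: median_ge0 => // y; exact: abse_ge0.
by apply: ereal_sup_ubound; exists 1%R => //=.
Qed.

(** Where [g] exceeds [k] it coincides with its truncation, so subtracting [k]
brings the superlevel sets of [g] into those of the part of [g] above [k]. *)
Lemma median_truncate gam (g : T -> R) (k : R) x r :
  (0 <= k)%R -> (0 < r)%R -> (gam <= 1)%R ->
  (forall y, (0 <= g y)%R) ->
  median mu gam (EFin \o g) (ball x r) <=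
  k%:E + median mu gam (EFin \o (g \_ [set y | k < g y]%R)) (ball x r).
Proof.
move=> k0 r0 g1 g0; rewrite -leeBlDl//; apply: le_median => a aP.
rewrite leeBlDl// -EFinD; apply: median_le; apply: le_lt_trans (aP).
have a0 : (0 <= a)%R.
  rewrite leNgt; apply/negP => a0.
  apply: (@ball_not_lt x r gam r0 g1); apply: le_lt_trans aP.
  apply: le_outer_measure => y xy; split => //=.
  by rewrite lte_fin (lt_le_trans a0)// patchE; case: ifP.
apply: le_outer_measure => y [xy /=]; rewrite !lte_fin => kag; split => //=.
have kg : (k < g y)%R by rewrite (le_lt_trans _ kag)// lerDl.
have ay : (a < g y)%R by rewrite (le_lt_trans _ kag)// lerDr.
by rewrite patchE mem_set.
Qed.

End Medians.

Section BallComparison.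
Context {R : realType} {T : pmetricType R}.
Context {mu : {outer_measure set T -> \bar R}} (kappa : R).
Local Open Scope ereal_scope.
Hypothesis kappa_ball : forall x z r, (0 < r)%R -> (mdist x z < r)%R ->
  kappa%:E * mu (ball z (2 * r)%R) <= mu (ball x r).

Lemma sub_ball_double (x z : T) (r : R) : (mdist x z < r)%R -> ball x r `<=` ball z (2 * r)%R.
Proof.
move=> xz y; rewrite !ballEmdist/= => xy.
rewrite (le_lt_trans (metric_triangle z x y))// (metric_sym z x).
by rewrite mulrDl mul1r ltrD.
Qed.

(** A centred maximal function dominates medians over balls centred elsewhere: the
ball is contained in [ball z (2 * r)], of comparable measure, and the loss is
absorbed by the factor [kappa] in the parameter. *)
Lemma median_le_maximal gam (g : T -> R) x z r : (0 < r)%R -> (mdist x z < r)%R ->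
  (0 < gam)%R -> (forall y, 0 <= g y)%R ->
  median mu gam (EFin \o g) (ball x r) <=
  median_maximal mu (kappa * gam) (EFin \o g) z.
Proof.
move=> r0 xz gam0 g0.
apply: (@le_trans _ _ (median mu (kappa * gam) (EFin \o g) (ball z (2 * r)%R))).
  apply: le_median => a aP; apply: median_le.
  apply: le_lt_trans (lt_le_trans aP _).
    by apply: le_outer_measure => y [xy ?]; split => //; exact: sub_ball_double xy.
  by rewrite (mulrC kappa) EFinM -muleA lee_pmul2l// kappa_ball.
apply: ereal_sup_ubound; exists (2 * r)%R => /=; first by rewrite mulr_gt0.
by congr (median _ _ _ _); apply/funext => y /=; rewrite ger0_norm.
Qed.

End BallComparison.

Section MaximalSeries.
Context {R : realType} {T : pmetricType R}.
Context {mu : {outer_measure set T -> \bar R}} (X : qbfs mu).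
Local Open Scope ereal_scope.
Hypothesis ball_pos : balls_pos_finite mu.

(** [Phi] only speaks of the unit ball of [X]; the maximal operator is homogeneous.
A bound [tau > 0] instead of the norm itself avoids dividing by zero. *)
Lemma maximal_bounded gam (K tau : R) f : Phi X gam <= K%:E -> (0 < tau)%R ->
  qb_set X f -> (qb_norm X f <= tau)%R ->
  qb_set X (median_maximal mu gam f) /\
  (qb_norm X (median_maximal mu gam f) <= K * tau)%R.
Proof.
move=> PhiK t0 Xf ft.
have ti0 : (0 < tau^-1)%R by rewrite invr_gt0.
have [Xf' Nf'] := qb_scaleP (ltW ti0) Xf.
have /normX_leP[XM NM] : normX X (median_maximal mu gam (fun x => tau^-1%:E * f x)) <= K%:E.
  apply: le_trans PhiK; apply: ereal_sup_ubound; eexists; last reflexivity.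
  by apply/normX_leP; split => //; rewrite Nf' ler_pdivrMl// mulr1.
have -> : median_maximal mu gam f =
    (fun x => tau%:E * median_maximal mu gam (fun x => tau^-1%:E * f x) x).
  rewrite median_maximal_scale//; apply/funext => x.
  by rewrite muleA -EFinM mulfV ?mul1e// gt_eqF.
have [XtM ->] := qb_scaleP (ltW t0) XM.
by split => //; rewrite mulrC ler_pM2r.
Qed.

Context (kappa q t : R).
Hypothesis kappa_ball : forall x z r, (0 < r)%R -> (mdist x z < r)%R ->
  kappa%:E * mu (ball z (2 * r)%R) <= mu (ball x r).
Hypotheses (kappa0 : (0 < kappa)%R) (q0 : (0 < q)%R) (q1 : (q < 1)%R).

(** A discrete form of the integral of [gam ^ (t - 1) * median gam g] over [gam];
it is the Lorentz norm of [g] with exponents [(1 / t, 1)] for the normalized measure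
of the ball. *)
Definition median_series (g : T -> R) x r : \bar R :=
  \sum_(i <oo) ((q ^+ i.+1) `^ t)%:E * median mu (q ^+ i.+1) (EFin \o g) (ball x r).

Definition maximal_series (g : T -> R) z : \bar R :=
  \sum_(i <oo) ((q ^+ i.+1) `^ t)%:E * median_maximal mu (kappa * q ^+ i.+1) (EFin \o g) z.

Let qi1 i : (q ^+ i.+1 <= 1)%R.
Proof. by rewrite exprn_ile1 ?ltW. Qed.

Let qi0 i : (0 < q ^+ i.+1)%R.
Proof. by rewrite exprn_gt0. Qed.

Lemma median_series_le g x z r : (0 < r)%R -> (mdist x z < r)%R ->
  (forall y, 0 <= g y)%R -> median_series g x r <= maximal_series g z.
Proof.
move=> r0 xz g0; apply: lee_nneseries => [i _ _|i _].
  by rewrite mule_ge0 ?lee_fin ?powR_ge0// median_ge0.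
by rewrite lee_pmul2l// ?lte_fin ?powR_gt0// median_le_maximal.
Qed.

Lemma median_series_ge g x r i : (0 < r)%R -> (forall y, 0 <= g y)%R ->
  ((q ^+ i.+1) `^ t)%:E * median mu (q ^+ i.+1) (EFin \o g) (ball x r) <=
  median_series g x r.
Proof.
move=> r0 g0.
have F0 j : 0 <= ((q ^+ j.+1) `^ t)%:E * median mu (q ^+ j.+1) (EFin \o g) (ball x r).
  by rewrite mule_ge0 ?lee_fin ?powR_ge0// median_ge0.
apply: le_trans (@nneseries_lim_ge _ _ xpredT 0 i.+1 (fun j _ _ => F0 j)).
by rewrite big_nat_recr//= leeDr// sume_ge0.
Qed.

Lemma weight_sum_le1 : (q `^ t <= 2^-1)%R ->
  \sum_(i <oo) ((q ^+ i.+1) `^ t)%:E <= 1 :> \bar R.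
Proof.
move=> qt; apply: lime_le.
  by apply: is_cvg_nneseries => i _ _; rewrite lee_fin powR_ge0.
apply: nearW => n; rewrite big_mkord sumEFin lee_fin.
suff : (\sum_(i < n) (q ^+ i.+1) `^ t <= 1 - 2^-1 ^+ n)%R.
  by move=> /le_trans; apply; rewrite gerBl exprn_ge0.
elim: n => [|n IH]; first by rewrite big_ord0 expr0 subrr.
rewrite big_ord_recr/= (le_trans (lerD IH (_ : _ <= 2^-1 ^+ n.+1)%R))//.
  rewrite -powR_mulrn ?(ltW q0)// -powRrM mulrC powRrM powR_mulrn ?powR_ge0//.
  by rewrite lerXn2r ?nnegrE ?powR_ge0.
by rewrite exprS; set a := (_ ^+ n)%R; lra.
Qed.

Lemma median_series_truncate (g : T -> R) (k : R) x r :
  (q `^ t <= 2^-1)%R -> (0 <= k)%R -> (0 < r)%R -> (forall y, 0 <= g y)%R ->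
  median_series g x r <= k%:E + median_series (g \_ [set y | k < g y]%R) x r.
Proof.
move=> qt k0 r0 g0.
have g10 y : 0 <= (EFin \o (g \_ [set y | k < g y]%R)) y.
  by rewrite /= lee_fin patchE; case: ifP.
have g1 i : 0 <= ((q ^+ i.+1) `^ t)%:E *
    median mu (q ^+ i.+1) (EFin \o (g \_ [set y | k < g y]%R)) (ball x r).
  by rewrite mule_ge0 ?lee_fin ?powR_ge0// median_ge0.
apply: (@le_trans _ _ (k%:E * \sum_(i <oo) ((q ^+ i.+1) `^ t)%:E +
    median_series (g \_ [set y | k < g y]%R) x r)); last first.
  rewrite leeD2r// -[leRHS]mule1 lee_wpmul2l ?lee_fin//; exact: weight_sum_le1.
rewrite -nneseriesZl//; last by move=> i _; rewrite lee_fin powR_ge0.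
rewrite -nneseriesD//; last by move=> i _ _; rewrite mule_ge0 ?lee_fin ?powR_ge0.
apply: lee_nneseries => [i _ _|i _].
  by rewrite mule_ge0 ?lee_fin ?powR_ge0// median_ge0.
rewrite muleC [k%:E * _]muleC -ge0_muleDr.
- by rewrite muleC lee_wpmul2l ?lee_fin ?powR_ge0// median_truncate.
- by rewrite lee_fin.
- by rewrite median_ge0.
Qed.

Context (c beta gam0 : R).
Hypothesis c1 : (1 <= c)%R.
Hypothesis qtriangle : forall f g, qb_set X f -> qb_set X g ->
  (qb_norm X (fun x => f x + g x) <= c * (qb_norm X f + qb_norm X g))%R.
Hypothesis PhiP : forall gam, (0 < gam)%R -> (gam < gam0)%R ->
  Phi X gam <= (gam `^ (- beta))%:E.
Hypothesis kqgam : (kappa * q < gam0)%R.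
Hypothesis kq1 : (kappa * q <= 1)%R.
Hypothesis qsmall : (q `^ (t - beta) <= (2 * c)^-1)%R.

(** By the bound on [Phi] the [i]-th term has norm at most a multiple of
[(q ^ (t - beta)) ^ i]. For [q] small this beats the factors [c ^ i] of the iterated
quasi-triangle inequality; a ratio [q] close to [1] would not do. *)
Lemma maximal_series_bounded (g : T -> R) (tau : R) : (0 < tau)%R ->
  qb_set X (EFin \o g) -> (qb_norm X (EFin \o g) <= tau)%R ->
  [/\ qb_set X (maximal_series g),
      (qb_norm X (maximal_series g) <= kappa `^ (- beta) * tau)%R &
      forall z, 0 <= maximal_series g z].
Proof.
move=> t0 Xg Ng.
have kq i : (kappa * q ^+ i.+1 <= kappa * q)%R.
  by rewrite ler_pM2l// exprS ler_piMr ?(ltW q0)// exprn_ile1 ?ltW.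
have kq0 i : (0 < kappa * q ^+ i.+1)%R by rewrite mulr_gt0.
have MB i := maximal_bounded (PhiP (kq0 i) (le_lt_trans (kq i) kqgam)) t0 Xg Ng.
have M0 i z : 0 <= ((q ^+ i.+1) `^ t)%:E *
    median_maximal mu (kappa * q ^+ i.+1) (EFin \o g) z.
  by rewrite mule_ge0 ?lee_fin ?powR_ge0// median_maximal_ge0// (le_trans (kq i)).
have [|||XS NS] := @qb_series _ _ _ X c c1 qtriangle (fun i z => ((q ^+ i.+1) `^ t)%:E *
    median_maximal mu (kappa * q ^+ i.+1) (EFin \o g) z) (kappa `^ (- beta) * tau)%R.
- by move=> i; have [XM _] := MB i; have [] := qb_scaleP (powR_ge0 (q ^+ i.+1) t) XM.
- by [].
- move=> i; have [XM NM] := MB i.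
  have [_ ->] := qb_scaleP (powR_ge0 (q ^+ i.+1) t) XM.
  apply: (le_trans (ler_wpM2l (powR_ge0 _ _) NM)).
  rewrite powRM ?(ltW kappa0)// ?(ltW (qi0 i))//.
  have -> : ((q ^+ i.+1) `^ t * (kappa `^ (- beta) * (q ^+ i.+1) `^ (- beta) * tau) =
     kappa `^ (- beta) * tau * (q ^+ i.+1) `^ (t - beta))%R.
    rewrite powRD; last by apply/implyP => _; rewrite gt_eqF.
    by ring.
  rewrite ler_wpM2l ?mulr_ge0 ?powR_ge0// ?(ltW t0)//.
  rewrite -powR_mulrn ?(ltW q0)// -powRrM mulrC powRrM powR_mulrn ?powR_ge0//.
  by rewrite -exprVn lerXn2r ?nnegrE ?powR_ge0// invr_ge0 mulr_ge0// (le_trans ler01).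
by split => // z; apply: nneseries_ge0.
Qed.

End MaximalSeries.

(** * The gradient on small balls *)

Section Vanishing.
Context {R : realType} {T : pmetricType R}.
Context {mu : {outer_measure set T -> \bar R}} (X : qbfs mu) (s : R).
Hypothesis ball_pos : balls_pos_finite mu.
Hypothesis open_cara : forall U : set T, open U -> mu.-caratheodory U.
Hypothesis X_ac : absolutely_continuous_qnorm X.
Hypotheses (s0 : 0 < s) (s1 : s <= 1).

Lemma restrict_small (f : T -> R) (A : nat -> set T) (tau : R) :
  qb_set X (EFin \o f) -> (forall k, mu.-caratheodory (A k)) ->
  (forall k, A k.+1 `<=` A k) -> \bigcap_k A k = set0 -> 0 < tau ->
  \forall k \near \oo, qb_set X (EFin \o (f \_ (A k))) /\
    qb_norm X (EFin \o (f \_ (A k))) <= tau.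
Proof.
move=> Xf mA dA A0 tau0.
have lt0 : (0 < tau%:E)%E by rewrite lte_fin.
have : \forall k \near \oo, (normX X ((EFin \o f) \_ (A k)) < tau%:E)%E.
  exact: (X_ac Xf mA dA A0 (open_ereal_lt' lt0)).
apply: filterS => k.
rewrite (_ : (EFin \o f) \_ (A k) = EFin \o (f \_ (A k))).
  by move=> /normX_ltP[? /ltW].
by apply/funext => x; rewrite /= !patchE; case: ifP.
Qed.

Lemma truncate_small (g : T -> R) (tau : R) : qb_set X (EFin \o g) -> 0 < tau ->
  exists k : nat, qb_set X (EFin \o (g \_ [set y | k%:R < g y])) /\
    qb_norm X (EFin \o (g \_ [set y | k%:R < g y])) <= tau.
Proof.
move=> Xg tau0.
have [|||k _ kP] := @restrict_small g (fun k => [set y | k%:R < g y]) tau Xg _ _ _ tau0.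
- move=> k; rewrite (_ : [set y | k%:R < g y] = [set: T] `&` [set y | (k%:R%:E < (EFin \o g) y)%E]).
    by apply: (@emeasurable_fun_o_infty _ (caratheodory_type mu)) => //; exact: qb_measurable Xg.
  by rewrite setTI.
- by move=> k y /=; apply: lt_trans; rewrite ltr_nat.
- rewrite -subset0 => y /(_ (Num.bound `|g y|) I)/=.
  apply/negP; rewrite -leNgt; apply/ltW/(le_lt_trans (ler_norm _)).
  exact: archi_boundP.
by exists k; apply: kP => /=.
Qed.

Context (kappa q t : R).
Hypothesis kappa_ball : forall (x z : T) r, (0 < r)%R -> (mdist x z < r)%R ->
  (kappa%:E * mu (ball z (2 * r)%R) <= mu (ball x r))%E.
Hypotheses (kappa0 : (0 < kappa)%R) (q0 : (0 < q)%R) (q1 : (q < 1)%R).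
Hypothesis qt : (q `^ t <= 2^-1)%R.
Context (c beta gam0 : R).
Hypothesis c1 : (1 <= c)%R.
Hypothesis qtriangle : forall f g, qb_set X f -> qb_set X g ->
  (qb_norm X (fun x => f x + g x)%E <= c * (qb_norm X f + qb_norm X g))%R.
Hypothesis PhiP : forall gam, (0 < gam)%R -> (gam < gam0)%R ->
  (Phi X gam <= (gam `^ (- beta))%:E)%E.
Hypothesis kqgam : (kappa * q < gam0)%R.
Hypothesis kq1 : (kappa * q <= 1)%R.
Hypothesis qsmall : (q `^ (t - beta) <= (2 * c)^-1)%R.

Let P (g : T -> R) x r := @median_series R T mu q t g x r.

(** On the balls in question [r ^- s] is below [maximal_series g / lambda] at every
point, so this function dominates the gradient of the tents; as [r <= 1], it also
dominates the tents themselves. *)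
Lemma capacity_large_series (g : T -> R) (lambda tau : R) : 0 < lambda -> 0 < tau ->
  (forall y, 0 <= g y) -> qb_set X (EFin \o g) -> qb_norm X (EFin \o g) <= tau ->
  (capacity X s [set x | exists r, (0 < r <= 1)%R /\ (lambda%:E < (r `^ s)%:E * P g x r)%E]
    <= (4 / lambda * (kappa `^ (- beta) * tau))%:E)%E.
Proof.
move=> l0 tau0 g0 Xg Ng.
have [XG NG G0] := maximal_series_bounded ball_pos kappa0 q0 q1 c1 qtriangle
  PhiP kqgam kq1 qsmall tau0 Xg Ng.
set G := maximal_series _ _ _ _ in XG NG G0.
have [XfG NfG] := qb_fine XG.
have l2 : 0 <= 2 / lambda by rewrite divr_ge0// ltW.
have [XH NH] := qb_scaleP l2 XfG.
pose H z := 2 / lambda * fine (G z).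
have H0 z : 0 <= H z by rewrite mulr_ge0// fine_ge0.
have fS z r x : ~ G z \isn't a fin_num -> (0 < r <= 1)%R -> (lambda%:E < (r `^ s)%:E * P g x r)%E ->
    mdist x z < r -> lambda < r `^ s * fine (G z).
  move=> /negP/negPn Gz /andP[r0 r1] lP xz; rewrite -lte_fin EFinM fineK//.
  apply: (lt_le_trans lP); rewrite lee_pmul2l// ?lte_fin ?powR_gt0//.
  exact: median_series_le.
apply: le_trans
  (@capacity_tents _ _ _ X s open_cara
    (fun x r => (0 < r <= 1)%R /\ (lambda%:E < (r `^ s)%:E * P g x r)%E)
    (cst 0) H H [set z | G z \isn't a fin_num] _ _ _ _ _ _ _ _ _ _ _) _ => //.
- by move=> x r [/andP[]].
- exact: qb_fin XG.
- by move=> z _; rewrite normr0.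
- by move=> z y _ _; rewrite add0r mulr_ge0 ?powR_ge0 ?addr_ge0.
- move=> x r z [r01 lP] Gz xz.
  have lr := fS _ _ _ Gz r01 lP xz.
  have /andP[r0 r1] := r01.
  have rs1 : r `^ s <= 1.
    have <- : 1 `^ s = 1 :> R by rewrite powR1.
    by apply: ge0_ler_powR; rewrite ?nnegrE// ltW.
  have lG : lambda < fine (G z).
    by rewrite (lt_le_trans lr)// ler_piMl// fine_ge0.
  by rewrite /H -mulrA ler_peMr// mulrC ler_pdivlMr// mul1r ltW.
- move=> x r z y [r01 lP] Gz _ xz _.
  have lr := fS _ _ _ Gz r01 lP xz.
  have /andP[r0 r1] := r01.
  rewrite -lerBlDl.
  have -> : Num.max (cst 0 y) (tent x r y) = tent x r y.
    by apply/max_idPr; exact: tent_ge0.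
  apply: (le_trans (tent_holder x z y s0 s1 r0)).
  rewrite powRM ?mdist_ge0 ?invr_ge0 ?(ltW r0)//.
  rewrite mulrCA ler_wpM2l ?powR_ge0//.
  rewrite -powR_inv1 ?(ltW r0)// powRAC powR_inv1 ?powR_ge0//.
  apply: (@le_trans _ _ (H z)); last by rewrite lerDl.
  rewrite /H -mulrA ler_pM2l// mulrC ler_pdivlMr// mulrC.
  by rewrite ler_pdivrMr ?powR_gt0// mulrC ltW.
have -> : EFin \o H = (fun x => (2 / lambda)%:E * (EFin \o fine \o G) x)%E.
  by apply/funext => z; rewrite /H /= EFinM.
rewrite NH lee_fin.
have -> : 4 / lambda * (kappa `^ (- beta) * tau) =
    2 / lambda * (kappa `^ (- beta) * tau) + 2 / lambda * (kappa `^ (- beta) * tau).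
  by field; rewrite gt_eqF.
by rewrite lerD// ler_wpM2l// (le_trans NfG).
Qed.

(** The part of [g] below [k] contributes at most [r ^ s * k], and the part above
[k] has small norm for [k] large, so [capacity_large_series] applies to it. *)
Lemma median_series_vanishes (g : T -> R) :
  (forall y, 0 <= g y) -> qb_set X (EFin \o g) ->
  cap_null X s [set x | ~ forall e, 0 < e -> exists2 d, 0 < d &
    forall r, 0 < r -> r < d -> ((r `^ s)%:E * P g x r <= e%:E)%E].
Proof.
move=> g0 Xg.
pose A (l : R) := [set x | forall d, 0 < d ->
  exists r, 0 < r < d /\ (l%:E < (r `^ s)%:E * P g x r)%E].
suff A0 l : 0 < l -> cap_null X s (A l).
  apply: (@cap_null_sub _ _ _ _ _ _ (\bigcup_n A n.+1%:R^-1)).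
    move=> x /existsNP[e /not_implyP[e0 /forall2NP He]].
    have [n _ ne] : \forall n \near \oo, n.+1%:R^-1 < e by exact: near_infty_natSinv_lt (PosNum e0).
    exists n => // d d0; have [//|/existsNP[r /not_implyP[r0 /not_implyP[rd /negP]]]] := He d.
    rewrite -ltNge => er; exists r; rewrite r0 rd; split => //.
    by apply: lt_trans er; rewrite lte_fin ne//=.
  by apply: cap_null_bigcup => n; apply: A0; rewrite invr_gt0.
move=> l0; apply/cap_nullP => e e0.
pose tau := e / (4 / (l / 2) * kappa `^ (- beta)).
have K0 : 0 < 4 / (l / 2) * kappa `^ (- beta) by rewrite mulr_gt0 ?powR_gt0// !divr_gt0.
have tau0 : 0 < tau by rewrite divr_gt0.
have [k [Xk Nk]] := truncate_small Xg tau0.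
have l20 : 0 < l / 2 by rewrite divr_gt0.
have gk0 y : 0 <= (g \_ [set y | k%:R < g y]) y by rewrite patchE; case: ifP.
have := capacity_large_series l20 tau0 gk0 Xk Nk.
rewrite mulrA [X in (_ <= X%:E)%E -> _](_ : _ = e); last first.
  by rewrite /tau mulrC divfK// gt_eqF.
apply: le_trans; apply: capacity_sub => x Ax.
(* r^s k is below l/2 once r is below this radius *)
pose d := minr 1 ((l / 2 / (k%:R + 1)) `^ s^-1).
have k1 : 0 < k%:R + 1 :> R by rewrite ltr_wpDl.
have d0 : 0 < d by rewrite lt_min ltr01 powR_gt0 ?divr_gt0.
have [r [/andP[r0 rd] lP]] := Ax d d0.
move: rd; rewrite lt_min => /andP[r1 rl].
exists r; rewrite r0 (ltW r1); split => //.
have rs : r `^ s * k%:R <= l / 2.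
  have : r `^ s <= l / 2 / (k%:R + 1).
    have -> : l / 2 / (k%:R + 1) = ((l / 2 / (k%:R + 1)) `^ s^-1) `^ s.
      by rewrite -powRrM mulVf ?gt_eqF// powRr1// ltW// divr_gt0.
    by apply: ge0_ler_powR; rewrite ?nnegrE ?powR_ge0// ltW.
  rewrite ler_pdivlMr//; apply: le_trans.
  by rewrite ler_wpM2l ?powR_ge0// lerDl.
rewrite ltNge; apply/negP => le2.
move: lP; apply/negP; rewrite -leNgt.
have le3 : ((r `^ s)%:E * P g x r <= (r `^ s)%:E * (k%:R%:E +
    P (g \_ [set y | (k%:R < g y)%R]) x r))%E.
  by rewrite lee_pmul2l ?lte_fin ?powR_gt0//; exact: median_series_truncate.
apply: (le_trans le3); rewrite ge0_muleDr ?lee_fin//; last first.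
  apply: nneseries_ge0 => i _ _; rewrite mule_ge0 ?lee_fin ?powR_ge0//.
  by apply: median_ge0 => //; rewrite exprn_ile1// ltW.
have -> : l%:E = ((l / 2)%:E + (l / 2)%:E)%E by rewrite -EFinD -splitr.
by apply: leeD => //; rewrite -EFinM lee_fin.
Qed.

End Vanishing.

(** * Balls half filled by a superlevel set *)

Section Density.
Context {R : realType} {T : pmetricType R}.
Context {mu : {outer_measure set T -> \bar R}} (X : qbfs mu) (s : R).
Hypothesis ball_pos : balls_pos_finite mu.
Hypothesis open_cara : forall U : set T, open U -> mu.-caratheodory U.
Hypotheses (s0 : 0 < s) (s1 : s <= 1).

Definition half_filled (A : set T) : set T :=
  [set x | exists r : R, 0 < r /\ ((2^-1)%:E * mu (ball x r) <= mu (ball x r `&` A))%E].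

Lemma half_filled_point (A1 A2 B N : set T) :
  ((2^-1)%:E * mu B <= mu (B `&` A1))%E ->
  (mu (B `&` A2) < (2^-1)%:E * mu B)%E -> mu N = 0%E ->
  exists p, [/\ B p, A1 p, ~ A2 p & ~ N p].
Proof.
move=> le1 lt2 N0; apply/not_existsP => nP.
have : (mu (B `&` A1) <= mu (B `&` A2))%E.
  rewrite -[leRHS]adde0 -N0; apply: le_trans (outer_measureU2 mu _ _).
  apply: le_outer_measure => p [Bp A1p].
  have [A2p|A2p] := pselect (A2 p); first by left.
  by right; apply: contrapT => Np; apply: (nP p).
by apply/negP; rewrite -ltNge; exact: lt_le_trans le1.
Qed.

Lemma powR_le3 (a b : R) : 0 <= a -> 0 <= b -> a <= 3 * b -> a `^ s <= 3 * b `^ s.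
Proof.
move=> a0 b0 ab; apply: (@le_trans _ _ ((3 * b) `^ s)).
  by apply: ge0_ler_powR; rewrite ?nnegrE ?mulr_ge0// ltW.
by rewrite powRM// ler_wpM2r ?powR_ge0// ler1_powR//; lra.
Qed.

(** The jump from [Fp >= 1] to [4 * Fy < 2] costs gradient: it forces
[a + hy >= 1 / (6 r^s)] if [y] is within [r] of [z], which pays for the slope of the
tent, and it bounds the jump [2 - 4 * Fy] directly if [y] is far from [z], because
then [mdist p y] is at most three times [mdist z y]. *)
Lemma tent_gradient_dense (x z y p : T) (r a Fy Fp hy : R) :
  0 < r -> mdist x z < r -> mdist x p < r -> 4 * Fy < tent x r z -> 1 <= Fp ->
  0 <= a -> 0 <= hy -> Fp <= Fy + mdist p y `^ s * (a + hy) ->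
  tent x r z <= Num.max (4 * Fy) (tent x r y) + mdist z y `^ s * (12 * (a + hy)).
Proof.
move=> r0 xz xp Fyz Fp1 a0 hy0 Fpy.
have tz2 := tent_le2 x z r0.
have dpy : mdist p y <= 2 * r + mdist z y.
  have := metric_triangle p x y; have := metric_triangle x z y.
  by rewrite (metric_sym p x); lra.
have ah0 : 0 <= a + hy by rewrite addr_ge0.
have := mdist_ge0 z y => D0.
have [rD|Dr] := leP r (mdist z y).
  have le1 : mdist p y `^ s <= 3 * mdist z y `^ s.
    by apply: powR_le3; rewrite ?mdist_ge0//; lra.
  have := ler_wpM2r ah0 le1 => le2.
  have le3 : 4 * Fy <= Num.max (4 * Fy) (tent x r y) by rewrite le_max lexx.
  have -> : mdist z y `^ s * (12 * (a + hy)) = 4 * (3 * mdist z y `^ s * (a + hy)) by ring.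
  lra.
have le1 : mdist p y `^ s <= 3 * r `^ s.
  by apply: powR_le3; rewrite ?mdist_ge0 ?(ltW r0)//; lra.
have := ler_wpM2r ah0 le1 => le2.
have le3 : tent x r y <= Num.max (4 * Fy) (tent x r y) by rewrite le_max lexx orbT.
have := tent_holder x z y s0 s1 r0.
have -> : (mdist z y / r) `^ s = mdist z y `^ s / r `^ s.
  rewrite powRM ?mdist_ge0 ?invr_ge0 ?(ltW r0)//.
  by rewrite -powR_inv1 ?(ltW r0)// powRAC powR_inv1 ?powR_ge0.
have rs0 : 0 < r `^ s by rewrite powR_gt0.
have le4 : (r `^ s)^-1 <= 6 * (a + hy).
  by rewrite -[leLHS]mul1r ler_pdivrMr//; lra.
have := ler_wpM2l (powR_ge0 (mdist z y) s) le4.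
set A := _ `^ s * (6 * _); have -> : mdist z y `^ s * (12 * (a + hy)) = 2 * A by rewrite /A; ring.
lra.
Qed.

Context (kappa gam K c : R).
Hypothesis kappa_ball : forall (x z : T) r, (0 < r)%R -> (mdist x z < r)%R ->
  (kappa%:E * mu (ball z (2 * r)%R) <= mu (ball x r))%E.
Hypotheses (gam_kappa : gam <= kappa / 2) (gam1 : gam <= 1).
Hypothesis PhiK : (Phi X gam <= K%:E)%E.
Hypothesis c1 : (1 <= c)%R.
Hypothesis qtriangle : forall f g, qb_set X f -> qb_set X g ->
  (qb_norm X (fun x => f x + g x)%E <= c * (qb_norm X f + qb_norm X g))%R.

Lemma gam_ball_half (x z : T) r : 0 < r -> mdist x z < r ->
  (gam%:E * mu (ball z (2 * r)) <= (2^-1)%:E * mu (ball x r))%E.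
Proof.
move=> r0 xz; apply: (@le_trans _ _ ((kappa / 2)%:E * mu (ball z (2 * r)))%E).
  by rewrite lee_wpmul2r ?lee_fin// outer_measure_ge0.
by rewrite (mulrC kappa) EFinM -muleA lee_pmul2l// kappa_ball.
Qed.

Lemma le_maximal_of_half_filled (F : T -> R) (x z : T) r : 0 < r -> mdist x z < r ->
  ((2^-1)%:E * mu (ball x r) <= mu (ball x r `&` [set y | (1 <= F y)%R]))%E ->
  (1 <= median_maximal mu gam (EFin \o F) z)%E.
Proof.
move=> r0 xz Fx.
apply: (@le_trans _ _ (median mu gam (fun y => `|(EFin \o F) y|%E) (ball z (2 * r)))).
  apply: le_median => a aP; rewrite lee_fin leNgt; apply/negP => a1.
  move: (gam_ball_half r0 xz); apply/negP; rewrite -ltNge.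
  apply: le_lt_trans aP; apply: le_trans Fx _.
  apply: le_outer_measure => y [xy /= Fy]; split; first exact: sub_ball_double xy.
  by rewrite /= lte_fin (lt_le_trans a1)// (le_trans Fy)// ler_norm.
by apply: ereal_sup_ubound; exists (2 * r); rewrite //= mulr_gt0.
Qed.

Lemma maximal_lt_half (h : T -> R) (x z : T) r a : 0 < r -> mdist x z < r ->
  (forall y, 0 <= h y) -> (median_maximal mu gam (EFin \o h) z < a%:E)%E ->
  (mu (ball x r `&` [set y | (a < h y)%R]) < (2^-1)%:E * mu (ball x r))%E.
Proof.
move=> r0 xz h0 Ma; apply: lt_le_trans (gam_ball_half r0 xz).
have /lt_median : (median mu gam (fun y => `|(EFin \o h) y|%E) (ball z (2 * r)) < a%:E)%E.
  apply: le_lt_trans Ma; apply: ereal_sup_ubound.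
  by exists (2 * r); rewrite //= mulr_gt0.
apply: le_lt_trans; apply: le_outer_measure => y [xy /= ahy].
split; first exact: sub_ball_double xy.
by rewrite /= lte_fin ger0_norm.
Qed.

(** A weak type estimate. The constants [4] and [12] come from
[tent_gradient_dense]; [1 <= median_maximal mu gam F] on half filled balls bounds
the tents in [X]. *)
Lemma capacity_half_filled (F h : T -> R) (N : set T) (tau : R) : 0 < tau ->
  qb_set X (EFin \o F) -> qb_norm X (EFin \o F) <= tau ->
  qb_set X (EFin \o h) -> qb_norm X (EFin \o h) <= tau ->
  (forall y, 0 <= h y) -> mu N = 0%E ->
  (forall z y, ~ N z -> ~ N y -> F z <= F y + mdist z y `^ s * (h z + h y)) ->
  (capacity X s (half_filled [set y | (1 <= F y)%R]%R) <= ((c * (16 + 14 * K)) * tau)%:E)%E.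
Proof.
move=> tau0 XF NF Xh Nh h0 N0 grad.
have [XMF NMF] := maximal_bounded PhiK tau0 XF NF.
have [XMh NMh] := maximal_bounded PhiK tau0 Xh Nh.
set MF := median_maximal mu gam (EFin \o F) in XMF NMF.
set Mh := median_maximal mu gam (EFin \o h) in XMh NMh.
have [XfMF NfMF] := qb_fine XMF; have [XfMh NfMh] := qb_fine XMh.
have Mh0 z : 0 <= fine (Mh z) by rewrite fine_ge0// median_maximal_ge0.
have MF0 z : 0 <= fine (MF z) by rewrite fine_ge0// median_maximal_ge0.
have [XaF NaF] := qb_abse XF.
have [X4F N4F] := qb_scaleP (ler0n R 4) XaF.
have [X2M N2M] := qb_scaleP (ler0n R 2) XfMF.
have [X12h N12h] := qb_scaleP (ler0n R 12) Xh.
have [X12M N12M] := qb_scaleP (ler0n R 12) XfMh.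
pose G z := 4 * `|F z| + 2 * fine (MF z).
pose H z := 12 * fine (Mh z) + 12 * h z.
have c0 : 0 <= c by rewrite (le_trans ler01).
have XG : qb_set X (EFin \o G) by have := qb_add X4F X2M.
have NG : qb_norm X (EFin \o G) <= c * (4 * tau + 2 * (K * tau)).
  apply: (le_trans (qtriangle X4F X2M)); rewrite ler_wpM2l// N4F N2M lerD// ler_wpM2l//.
    exact: le_trans NF.
  exact: le_trans NMF.
have XH : qb_set X (EFin \o H) by have := qb_add X12M X12h.
have NH : qb_norm X (EFin \o H) <= c * (12 * (K * tau) + 12 * tau).
  apply: (le_trans (qtriangle X12M X12h)); rewrite ler_wpM2l// N12M N12h lerD// ler_wpM2l//.
  exact: le_trans NMh.
have H0 z : 0 <= H z by rewrite addr_ge0 ?mulr_ge0.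
have hH z : 12 * h z <= H z by rewrite lerDr mulr_ge0.
pose N' := N `|` ([set z | MF z \isn't a fin_num] `|` [set z | Mh z \isn't a fin_num]).
apply: (@le_trans _ _ (qb_norm X (EFin \o G) + qb_norm X (EFin \o H))%:E); last first.
  by rewrite lee_fin; apply: (le_trans (lerD NG NH)); rewrite -mulrDr -mulrA ler_wpM2l//; lra.
apply: (@capacity_tents _ _ _ X s open_cara
  (fun x r => 0 < r /\ ((2^-1)%:E * mu (ball x r) <= mu (ball x r `&` [set y | (1 <= F y)%R]))%E)
  (fun z => 4 * F z) G H N') => //.
- by move=> x r [].
- by apply: measurable_funM => //; apply/measurable_EFinP; exact: (qb_measurable XF).
- by move=> z; rewrite addr_ge0 ?mulr_ge0.
- by apply: outer_nullU => //; apply: outer_nullU; [exact: (qb_fin XMF)|exact: (qb_fin XMh)].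
- by move=> z _; rewrite normrM ger0_norm// lerDl mulr_ge0.
- move=> z y /not_orP[Nz _] /not_orP[Ny _].
  have := grad z y Nz Ny.
  have : mdist z y `^ s * (12 * h z + 12 * h y) <= mdist z y `^ s * (H z + H y).
    by rewrite ler_wpM2l ?powR_ge0// lerD.
  have : 0 <= mdist z y `^ s * (h z + h y) by rewrite mulr_ge0 ?powR_ge0 ?addr_ge0.
  rewrite -mulrDr mulrCA; lra.
- move=> x r z [r0 Fx] /not_orP[_ /not_orP[/negP/negPn MFz _]] xz.
  have := le_maximal_of_half_filled r0 xz Fx.
  rewrite -/MF -(fineK MFz) lee_fin /G.
  have : 0 <= 4 * `|F z| by rewrite mulr_ge0.
  lra.
- move=> x r z y [r0 Fx] /not_orP[Nz /not_orP[_ /negP/negPn Mhz]] /not_orP[Ny _] xz Fyz.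
  apply/ler_addgt0Pr => e e0.
  pose D := mdist z y `^ s; have D0 : 0 <= D by exact: powR_ge0.
  have D1 : 0 < 12 * D + 1 by rewrite ltr_wpDl// mulr_ge0.
  (* the superlevel set of h is small only for levels strictly above Mh z *)
  pose e' := e / (12 * D + 1); have e'0 : 0 < e' by rewrite divr_gt0.
  pose a := fine (Mh z) + e'.
  have Mha : (Mh z < a%:E)%E by rewrite -(fineK Mhz) lte_fin ltrDl.
  have [p [xp Fp /negP hp Np]] :=
    half_filled_point Fx (maximal_lt_half r0 xz h0 Mha) N0.
  rewrite -leNgt in hp; rewrite ballEmdist/= in xp.
  have a0 : 0 <= a by rewrite addr_ge0// ltW.
  have Fpy : F p <= F y + mdist p y `^ s * (a + h y).
    by rewrite (le_trans (grad p y Np Ny))// lerD2l ler_wpM2l ?powR_ge0// lerD2r.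
  have := tent_gradient_dense r0 xz xp Fyz Fp a0 (h0 y) Fpy.
  move=> /le_trans; apply; rewrite -[leRHS]addrA lerD2l -/D.
  have De : 12 * D * e' <= e.
    by rewrite /e' mulrCA ler_piMr ?(ltW e0)// ler_pdivrMr// mul1r lerDl.
  have : D * (12 * fine (Mh z) + 12 * h y) <= D * (H z + H y).
    rewrite ler_wpM2l// lerD//; first by rewrite /H lerDl mulr_ge0.
  have -> : D * (12 * (a + h y)) = D * (12 * fine (Mh z) + 12 * h y) + 12 * D * e'.
    by rewrite /a; ring.
  lra.
Qed.

End Density.

(** * Quasicontinuous functions *)

Section Quasicontinuity.
Context {R : realType} {T : pmetricType R}.
Context {mu : {outer_measure set T -> \bar R}} (X : qbfs mu) (s : R).
Hypothesis ball_pos : balls_pos_finite mu.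
Hypothesis open_cara : forall U : set T, open U -> mu.-caratheodory U.
Hypothesis X_ac : absolutely_continuous_qnorm X.
Hypotheses (s0 : 0 < s) (s1 : s <= 1).
Context (C c : R).
Hypothesis C0 : 0 < C.
Hypothesis half_filled_le : forall (F h : T -> R) (N : set T) (tau : R), 0 < tau ->
  qb_set X (EFin \o F) -> qb_norm X (EFin \o F) <= tau ->
  qb_set X (EFin \o h) -> qb_norm X (EFin \o h) <= tau ->
  (forall y, 0 <= h y) -> mu N = 0%E ->
  (forall z y, ~ N z -> ~ N y -> F z <= F y + mdist z y `^ s * (h z + h y)) ->
  (capacity X s (half_filled (mu := mu) [set y | (1 <= F y)%R]) <= (C * tau)%:E)%E.
Hypothesis c1 : (1 <= c)%R.
Hypothesis qtriangle : forall f g, qb_set X f -> qb_set X g ->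
  (qb_norm X (fun x => f x + g x)%E <= c * (qb_norm X f + qb_norm X g))%R.

Lemma half_filled_sub (A A' N : set T) : mu N = 0%E -> A `<=` A' `|` N ->
  half_filled (mu := mu) A `<=` half_filled (mu := mu) A'.
Proof.
move=> N0 AA' x [r [r0 le1]]; exists r; split => //; apply: (le_trans le1).
rewrite -[leRHS]adde0 -N0; apply: le_trans (outer_measureU2 mu _ _).
by apply: le_outer_measure => y [xy /AA'[]]; [left|right].
Qed.

Lemma capacity_half_filled_neighborhood (E : set T) (tau : R) : 0 < tau ->
  (capacity X s E < tau%:E)%E ->
  exists U, [/\ open U, E `<=` U & (capacity X s (half_filled (mu := mu) U) <= (C * tau)%:E)%E].
Proof.
move=> tau0 /capacity_witness[F [h [N [U [[XF Xh h0 [NF Nh]] [N0 fN grad [oU EU FU]]]]]]].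
exists U; split => //.
have [XfF NfF] := qb_fine XF; have [Xfh Nfh] := qb_fine Xh.
have h'0 y : 0 <= fine (h y) by rewrite fine_ge0.
have grad' z y : ~ N z -> ~ N y ->
    fine (F z) <= fine (F y) + mdist z y `^ s * (fine (h z) + fine (h y)).
  move=> Nz Ny; have := grad z y Nz Ny.
  have [Fz hz] := fN z Nz; have [Fy hy] := fN y Ny.
  rewrite -(fineK Fz) -(fineK Fy) -(fineK hz) -(fineK hy).
  move=> le0.
  have le1 : `|fine (F z) - fine (F y)| <= mdist z y `^ s * (fine (h z) + fine (h y)).
    by rewrite -lee_fin.
  by rewrite -lerBlDl; apply: le_trans le1; exact: ler_norm.
have := half_filled_le tau0 XfF (le_trans NfF (ltW NF)) Xfh
  (le_trans Nfh (ltW Nh)) h'0 N0 grad'.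
apply: le_trans; apply: capacity_sub; apply: (half_filled_sub N0) => y Uy.
have [Ny|Ny] := pselect (N y); [by right|left => /=].
have [Fy _] := fN y Ny.
by rewrite -lee_fin fineK// FU.
Qed.

(** [u] is continuous along the complement of [E], and more than half of each
ball about [x] lies outside [E]. The open set [U] spares the measurability
of [E]. *)
Definition quasicontinuity_point (u : T -> \bar R) (x : T) :=
  exists E U, [/\ open U, E `<=` U, {within ~` E, continuous u} &
    ~ half_filled (mu := mu) U x].

Lemma quasicontinuity_points u : quasicontinuous X s u ->
  cap_null X s [set x | ~ quasicontinuity_point u x].
Proof.
move=> u_qc; apply/cap_nullP => e e0.
have tau0 : 0 < e / C by rewrite divr_gt0.
have [E Etau cE] := u_qc _ tau0.
have [U [oU EU cU]] := capacity_half_filled_neighborhood tau0 Etau.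
rewrite mulrC divfK ?gt_eqF// in cU.
apply: le_trans cU; apply: capacity_sub => x /= nx.
by apply: contrapT => hU; apply: nx; exists E, U.
Qed.

Lemma not_half_filledP (A : set T) x : ~ half_filled (mu := mu) A x ->
  forall r : R, 0 < r -> (mu (ball x r `&` A) < (2^-1)%:E * mu (ball x r))%E.
Proof.
by move=> nA r r0; rewrite ltNge; apply/negP => le1; apply: nA; exists r.
Qed.

Lemma half_filled_open (U : set T) x : open U -> U x -> half_filled (mu := mu) U x.
Proof.
rewrite openE => oU /oU; rewrite /interior => /nbhs_ballP[r /= r0 xU].
exists r; split => //; rewrite (_ : ball x r `&` U = ball x r); last first.
  by apply/seteqP; split => [y []//|y xy]; split => //; exact: xU.
rewrite -[leRHS]mul1e lee_wpmul2r ?outer_measure_ge0// lee_fin; lra.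
Qed.

Lemma quasicontinuity_nbhs (u : T -> \bar R) x (V : set (\bar R)) :
  quasicontinuity_point u x -> nbhs (u x) V ->
  exists2 d : R, 0 < d & forall r : R, 0 < r -> r < d ->
   (mu (ball x r `&` [set y | ~ V (u y)]) < (2^-1)%:E * mu (ball x r))%E.
Proof.
move=> [E [U [oU EU cE nU]]] uV.
have nEx : ~ E x by move=> /EU /(half_filled_open oU).
have := (subspace_continuousP (~` E) u).1 cE x nEx.
move=> /(_ _ uV); rewrite /= => /nbhs_ballP[d /= d0 dV].
exists d => // r r0 rd; apply: le_lt_trans (not_half_filledP nU r0).
apply: le_outer_measure => y [xy nVy]; split => //; apply: EU.
apply: contrapT => nEy; apply: nVy; apply: dV => //.
by move: xy; rewrite !ballEmdist/= => /lt_trans; exact.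
Qed.

Lemma measurable_tent (x : T) (rho : R) : 0 < rho ->
  measurable_fun [set: caratheodory_type mu] (tent x rho).
Proof.
move=> rho0 _; apply: (measurability _ (RGenOInfty.measurableE R)) => //.
move=> _ [_ [a ->] <-]; rewrite setTI.
rewrite (_ : _ @^-1` _ = [set z | a < tent x rho z]); last first.
  by apply/seteqP; split => z; rewrite /= in_itv/= andbT.
have [a0|a0] := leP 0 a; last first.
  rewrite (_ : [set z | _] = setT) //.
  by apply/seteqP; split => // z _ /=; rewrite (lt_le_trans a0)// tent_ge0.
apply: open_cara; rewrite (_ : [set z | _] = ball x (rho * (1 - a / 2))).
  exact: open_mball.
by apply/seteqP; split => z; rewrite ballEmdist/= lt_tent.
Qed.

(** The test function [min (max 0 (|v| / k - 1)) (tent x0 rho)] vanishes off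
[A k], the set where [|v| > k], and off the ball. There it has gradient [g / k] from
the first factor and [2] from the second one, so that [g / k + 2 * \1_(A k)],
restricted to the ball, is a gradient. Both terms tend to [0] in [X]. *)
Lemma capacity_large_values (v g : T -> R) (N : set T) (x0 : T) (rho tau : R) :
  1 <= rho -> 0 < tau -> measurable_fun [set: caratheodory_type mu] v ->
  (forall y, 0 <= g y) -> qb_set X (EFin \o g) -> mu N = 0%E ->
  (forall z y, ~ N z -> ~ N y -> `|v z - v y| <= mdist z y `^ s * (g z + g y)) ->
  exists k : R, 0 < k /\ (capacity X s (half_filled (mu := mu)
    [set y | (mdist x0 y < rho / 2)%R /\ (2 * k <= `|v y|)%R]) <= tau%:E)%E.
Proof.
move=> rho1 tau0 mv g0 Xg N0 grad.
have rho0 : 0 < rho by rewrite (lt_le_trans ltr01).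
pose B := ball x0 rho.
pose b : T -> R := fun y => 2 * \1_B y.
have XB : qb_set X (EFin \o b).
  have XB1 : qb_set X (EFin \o \1_B).
    by apply: qb_indic; [exact/open_cara/open_mball|have /andP[] := ball_pos x0 rho0].
  by have [] := qb_scaleP (ler0n R 2) XB1.
have c0 : 0 < c by rewrite (lt_le_trans ltr01).
pose eps := tau / (C * (c * 2)).
have eps0 : 0 < eps by rewrite divr_gt0// !mulr_gt0.
pose A k := [set y | k%:R < `|v y|].
have mA k : mu.-caratheodory (A k).
  have mnv : measurable_fun [set: caratheodory_type mu] (fun y => (`|v y|)%:E).
    by apply/measurable_EFinP; apply: measurableT_comp.
  have := emeasurable_fun_o_infty (@measurableT _ (caratheodory_type mu)) mnv k%:R%:E.
  by rewrite setTI.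
have : \forall k \near \oo, qb_set X (EFin \o (b \_ (A k))) /\
    qb_norm X (EFin \o (b \_ (A k))) <= eps.
  apply: restrict_small => //.
  - by move=> k y /=; apply: lt_trans; rewrite ltr_nat.
  - rewrite -subset0 => y /(_ (Num.bound `|v y|) I)/=.
    by apply/negP; rewrite -leNgt ltW// archi_boundP.
move=> [k1 _ k1P].
pose k := maxn k1 (Num.bound (qb_norm X (EFin \o g) / eps)).+1.
have [XA NA] := k1P k (leq_maxl _ _).
have k0 : 0 < k%:R :> R by rewrite ltr0n (leq_trans _ (leq_maxr _ _)).
have ki0 : 0 <= k%:R^-1 :> R by rewrite invr_ge0 ltW.
have [Xgk Ngk'] := qb_scaleP ki0 Xg.
have Ngk : qb_norm X (fun x => k%:R^-1%:E * (EFin \o g) x)%E <= eps.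
  rewrite Ngk' ler_pdivrMl// mulrC -ler_pdivrMl// mulrC.
  have /archi_boundP/ltW/le_trans : 0 <= qb_norm X (EFin \o g) / eps.
    by rewrite divr_ge0 ?qb_norm_ge0// ltW.
  by apply; rewrite ler_nat (leq_trans _ (leq_maxr _ _)).
pose w z := Num.max 0 (`|v z| / k%:R - 1).
pose F z := Num.min (w z) (tent x0 rho z).
pose e z := (b \_ (A k)) z.
pose H z := k%:R^-1 * g z + e z.
have eE z : ~ F z <= 0 -> e z = 2.
  move=> /negP; rewrite -ltNge lt_min => /andP[wz tz].
  rewrite /e patchE mem_set/=.
    rewrite /b indicE mem_set ?mulr1//.
    by rewrite /B ballEmdist/=; exact: tent_gt0 tz.
  move: wz; rewrite /w lt_max ltxx/= subr_gt0 ltr_pdivlMr// mul1r.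
  by [].
have e0 z : 0 <= e z.
  by rewrite /e patchE; case: ifP => // _; rewrite /b mulr_ge0// indicE.
have F0 z : 0 <= F z by rewrite le_min tent_ge0 le_max lexx.
have Fe z : F z <= e z.
  have [/le_trans->//|/negP nF] := boolP (F z <= 0).
  by rewrite eE// ge_min tent_le2// orbT.
have mF : measurable_fun [set: caratheodory_type mu] F.
  apply: measurable_minr; last exact: measurable_tent.
  apply: measurable_maxr => //; apply: measurable_funB => //.
  by apply: measurable_funM => //; apply: measurableT_comp.
have [XF NF] : qb_set X (EFin \o F) /\ qb_norm X (EFin \o F) <= qb_norm X (EFin \o e).
  apply: (@qb_le _ _ _ _ set0) => //; first exact/measurable_EFinP.
  by move=> z _ /=; rewrite lee_fin !ger0_norm.
have XH : qb_set X (EFin \o H) by have := qb_add Xgk XA.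
have NH : qb_norm X (EFin \o H) <= c * 2 * eps.
  apply: (le_trans (qtriangle Xgk XA)); rewrite -mulrA ler_pM2l//.
  by rewrite mulr_natl mulr2n lerD.
have H0 z : 0 <= H z by rewrite addr_ge0 ?mulr_ge0.
have t0 : 0 < c * 2 * eps by rewrite mulr_gt0// mulr_gt0.
exists k%:R; split => //.
have tE : C * (c * 2 * eps) = tau.
  by rewrite /eps; field; rewrite !gt_eqF.
rewrite -tE.
have NF' : qb_norm X (EFin \o F) <= c * 2 * eps.
  by rewrite (le_trans NF)// (le_trans NA)// ler_peMl ?(ltW eps0)// mulr_ege1// ler1n.
apply: le_trans (half_filled_le t0 XF NF' XH NH H0 N0 _); last first.
  move=> z y Nz Ny.
  have D0 : 0 <= mdist z y `^ s by exact: powR_ge0.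
  have [Fz|nFz] := pselect (F z <= 0).
    by rewrite (le_trans Fz)// addr_ge0// mulr_ge0// addr_ge0.
  have ez := eE z nFz.
  have wz : w z = `|v z| / k%:R - 1.
    move/negP: nFz; rewrite -ltNge lt_min => /andP[+ _].
    rewrite /w; case: (leP 0 (`|v z| / k%:R - 1)) => //; by rewrite ltxx.
  have HD : mdist z y `^ s * (k%:R^-1 * (g z + g y) + 2) <= mdist z y `^ s * (H z + H y).
    by rewrite ler_wpM2l// /H ez mulrDr; have := e0 y; lra.
  have dg : 0 <= mdist z y `^ s * (k%:R^-1 * (g z + g y)).
    by rewrite !mulr_ge0// addr_ge0.
  rewrite -lerBlDl; apply: le_trans HD; rewrite mulrDr.
  have Fwz : F z <= w z by rewrite ge_min lexx.
  have Ftz : F z <= tent x0 rho z by rewrite ge_min lexx orbT.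
  rewrite {2}/F; case: (leP (w y) (tent x0 rho y)) => _.
    have wy : `|v y| / k%:R - 1 <= w y by rewrite le_max lexx orbT.
    have : (`|v z| - `|v y|) / k%:R <= mdist z y `^ s * (k%:R^-1 * (g z + g y)).
      rewrite mulrCA mulrC ler_wpM2l//; apply: le_trans (grad z y Nz Ny).
      exact: lerB_dist.
    rewrite mulrBl; have : 0 <= mdist z y `^ s * 2 by rewrite mulr_ge0.
    lra.
  have := tent_holder x0 z y s0 s1 rho0.
  have : (mdist z y / rho) `^ s <= mdist z y `^ s.
    apply: ge0_ler_powR; rewrite ?nnegrE ?mdist_ge0 ?divr_ge0 ?mdist_ge0 ?(ltW s0) ?(ltW rho0)//.
    by rewrite ler_pdivrMr// ler_peMr// mdist_ge0.
  lra.
apply: capacity_sub; apply: (@half_filled_sub _ _ set0) => // y [xy vk]; left => /=.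
rewrite le_min tent_ge1// andbT le_max; apply/orP; right.
by rewrite lerBrDr ler_pdivlMr.
Qed.

Lemma ereal_nbhs_large (v : \bar R) (k : R) : v \isn't a fin_num ->
  nbhs v [set w | (k%:E < `|w|)%E].
Proof.
case: v => [r//| |] _.
- exists k; split; first exact: num_real.
  by move=> w /= kw; rewrite (lt_le_trans kw)// lee_abs.
- exists (- k); split; first exact: num_real.
  move=> w /= wk; apply: lt_le_trans (_ : (- w <= _)%E); last by rewrite -abseN lee_abs.
  by rewrite lteNr -EFinN.
Qed.

(** Near a quasicontinuity point where [u] is infinite, [|u|] is large on more than
half of every small ball, so [capacity_large_values] applies with every
threshold. *)
Lemma infinite_value_null (u : T -> \bar R) (g : T -> R) (N : set T) :
  mu_measurable_fun mu u ->
  (forall y, 0 <= g y) -> qb_set X (EFin \o g) -> mu N = 0%E ->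
  (forall z, ~ N z -> u z \is a fin_num) ->
  (forall z y, ~ N z -> ~ N y ->
     `|fine (u z) - fine (u y)| <= mdist z y `^ s * (g z + g y)) ->
  cap_null X s [set x | quasicontinuity_point u x /\ u x \isn't a fin_num].
Proof.
move=> mu_u g0 Xg N0 fu grad.
have mv : measurable_fun [set: caratheodory_type mu] (fine \o u).
  by apply: measurableT_comp => //; exact: fine_measurable.
pose Z n := [set x | mdist point x < n.+1%:R /\
  (quasicontinuity_point u x /\ u x \isn't a fin_num)].
apply: (@cap_null_sub _ _ _ _ _ _ (\bigcup_n Z n)).
  move=> x hx; exists (Num.bound (mdist point x)) => //; split => //.
  rewrite (lt_trans (archi_boundP _)) ?mdist_ge0//; by rewrite ltr_nat.
apply: cap_null_bigcup => n; apply/cap_nullP => tau tau0.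
have rho1 : 1 <= 2 * n.+1%:R :> R by rewrite mulr_ege1// ler1n.
have [k [k0 cap_k]] := capacity_large_values point rho1 tau0 mv g0 Xg N0 grad.
apply: le_trans cap_k; apply: capacity_sub => x [xn [qx ux]].
have [d d0 dP] := quasicontinuity_nbhs qx (ereal_nbhs_large (2 * k) ux).
have xn0 : 0 < n.+1%:R - mdist point x by rewrite subr_gt0.
have [r /andP[r0 rd]] : exists r, 0 < r < minr d (n.+1%:R - mdist point x).
  have m0 : 0 < minr d (n.+1%:R - mdist point x) by rewrite lt_min d0 xn0.
  by exists (minr d (n.+1%:R - mdist point x) / 2); rewrite divr_gt0//= gtr_pMr// invf_lt1// ltr1n.
move: rd; rewrite lt_min => /andP[rd rn].
exists r; split => //; rewrite leNgt; apply/negP => lt1.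
have := dP r r0 rd; set A1 := _ `&` _ => lt2.
move: lt1; set A2 := _ `&` _ => lt1.
have : (mu (ball x r) <= mu A1 + mu A2)%E.
  rewrite -[leRHS]adde0 -N0.
  apply: le_trans (leeD2r (mu N) (outer_measureU2 mu A1 A2)).
  apply: le_trans (outer_measureU2 mu (A1 `|` A2) N).
  apply: le_outer_measure => y xy.
  have [Ny|Ny] := pselect (N y); first by right.
  left; have [Vy|Vy] := pselect (2 * k < `|fine (u y)|).
    right; split => //; split; last exact: ltW.
    rewrite mulrAC mulfV// mul1r.
    move: xy; rewrite ballEmdist/= => xy.
    by rewrite (le_lt_trans (metric_triangle _ x _))// -ltrBrDl (lt_trans xy).
  left; split => //; rewrite /= -(fineK (fu y Ny)) abse_EFin lte_fin.
  exact: Vy.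
have /andP[b0 boo] := ball_pos x r0.
apply/negP; rewrite -ltNge; apply: lt_le_trans (lteD lt2 lt1) _.
have /fineK <- : mu (ball x r) \is a fin_num by rewrite ge0_fin_numE// ltW.
by rewrite -EFinM -EFinD lee_fin; lra.
Qed.

(** Strictly less than half of the ball is excluded, so that a second condition that
fails on at most half of it holds at a common point. *)
Definition mostly_near (u : T -> \bar R) (x : T) :=
  u x \is a fin_num /\ forall eta : R, 0 < eta -> exists2 d : R, 0 < d &
    forall r : R, 0 < r -> r < d ->
    (mu (ball x r `&` [set y | ~ (`|u y - u x| < eta%:E)%E]) < (2^-1)%:E * mu (ball x r))%E.

Lemma ereal_nbhs_close (v : \bar R) (eta : R) : v \is a fin_num -> 0 < eta ->
  nbhs v [set w | (`|w - v| < eta%:E)%E].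
Proof.
case: v => // a _ eta0.
have H : nbhs a [set b : R | `|b - a| < eta].
  by apply/nbhs_ballP; exists eta => //= b; rewrite /ball/= distrC.
exact: H.
Qed.

Lemma mostly_near_qe (u : T -> \bar R) (g : T -> R) (N : set T) :
  mu_measurable_fun mu u ->
  (forall y, 0 <= g y) -> qb_set X (EFin \o g) -> mu N = 0%E ->
  (forall z, ~ N z -> u z \is a fin_num) ->
  (forall z y, ~ N z -> ~ N y ->
     `|fine (u z) - fine (u y)| <= mdist z y `^ s * (g z + g y)) ->
  quasicontinuous X s u -> cap_null X s [set x | ~ mostly_near u x].
Proof.
move=> mu_u g0 Xg N0 fu grad u_qc.
apply: cap_null_sub (cap_nullU (quasicontinuity_points u_qc)
  (infinite_value_null mu_u g0 Xg N0 fu grad)) => x /= nx.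
have [qx|] := pselect (quasicontinuity_point u x); last by left.
right; split => //; apply/negP => ux; apply: nx; split => // eta eta0.
exact: quasicontinuity_nbhs qx (ereal_nbhs_close ux eta0).
Qed.

End Quasicontinuity.

(** * Generalized Lebesgue points *)

Lemma cvge_of_close {R : realType} {I : Type} (F : set_system I) {FF : Filter F}
    (f : I -> \bar R) (a : R) :
  (forall e : R, 0 < e -> \forall i \near F, ((a - e)%:E <= f i <= (a + e)%:E)%E) ->
  f i @[i --> F] --> a%:E.
Proof.
move=> H V Va; have /nbhs_ballP[e /= e0 eV] : nbhs a (fun b : R => V b%:E) by exact: Va.
have e20 : 0 < e / 2 by rewrite divr_gt0.
apply: filterS (H _ e20) => i /=.
case: (f i) => [b| |]; rewrite ?leNye_eq ?leye_eq ?andbF ?lee_fin//.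
move=> /andP[ab ba]; apply: eV; rewrite /ball/= ltr_distl; apply/andP; split; lra.
Qed.

Section GeneralizedLebesguePoints.
Context {R : realType} {T : pmetricType R}.
Context {mu : {outer_measure set T -> \bar R}} (s : R).
Hypothesis ball_pos : balls_pos_finite mu.
Hypotheses (s0 : 0 < s) (s1 : s <= 1).
Context (u : T -> \bar R) (g : T -> R) (N : set T).
Hypothesis g0 : forall y, 0 <= g y.
Hypothesis N0 : mu N = 0%E.
Hypothesis fu : forall z, ~ N z -> u z \is a fin_num.
Hypothesis grad : forall z y, ~ N z -> ~ N y ->
  `|fine (u z) - fine (u y)| <= mdist z y `^ s * (g z + g y).

Lemma mball_fin (x : T) (r : R) : 0 < r -> mu (ball x r) \is a fin_num.
Proof.
by move=> r0; have /andP[b0 boo] := ball_pos x r0; rewrite ge0_fin_numE// ltW.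
Qed.

Lemma mball_gt0 (x : T) (r : R) : 0 < r -> 0 < fine (mu (ball x r)).
Proof. by move=> r0; rewrite fine_gt0//; exact: ball_pos. Qed.

Lemma common_good_point (x : T) (r a b : R) (A1 A2 : set T) : 0 < r ->
  (mu (ball x r `&` A1) < a%:E * mu (ball x r))%E ->
  (mu (ball x r `&` A2) < b%:E * mu (ball x r))%E -> a + b <= 1 ->
  exists p, [/\ ball x r p, ~ A1 p, ~ A2 p & ~ N p].
Proof.
move=> r0 lt1 lt2 ab; apply/not_existsP => nP.
have : (mu (ball x r) <= mu (ball x r `&` A1) + mu (ball x r `&` A2))%E.
  rewrite -[leRHS]adde0 -N0.
  apply: le_trans (leeD2r (mu N) (outer_measureU2 mu _ _)).
  apply: le_trans (outer_measureU2 mu _ _).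
  apply: le_outer_measure => p xp.
  have [A1p|A1p] := pselect (A1 p); first by left; left.
  have [A2p|A2p] := pselect (A2 p); first by left; right.
  by right; apply: contrapT => Np; apply: (nP p).
apply/negP; rewrite -ltNge; apply: lt_le_trans (lteD lt1 lt2) _.
rewrite -(fineK (mball_fin x r0)) -!EFinM -EFinD lee_fin -mulrDl.
by rewrite ler_piMl// ltW// mball_gt0.
Qed.

Definition approximately_continuous (x : T) := forall eta theta : R,
  0 < eta -> 0 < theta -> exists2 d : R, 0 < d & forall r : R, 0 < r -> r < d ->
  (mu (ball x r `&` [set y | (eta%:E < `|u y - u x|)%E]) < theta%:E * mu (ball x r))%E.

Lemma approximately_continuous_gen_lebesgue x : u x \is a fin_num ->
  approximately_continuous x -> gen_lebesgue_point mu u x.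
Proof.
move=> ux ac gam /andP[gam0 gam1].
have near_ac eta theta : 0 < eta -> 0 < theta -> \forall r \near 0^'+, 0 < r /\
    (mu (ball x r `&` [set y | (eta%:E < `|u y - u x|)%E]) < theta%:E * mu (ball x r))%E.
  move=> eta0 theta0; have [d d0 dP] := ac eta theta eta0 theta0.
  near=> r.
  have r0 : 0 < r by near: r; exact: nbhs_right_gt.
  split => //; apply: dP => //; near: r; exact: nbhs_right_lt.
split.
  apply: cvge_of_close => e e0; apply: filterS (near_ac _ _ e0 gam0) => r [r0 lt1].
  rewrite !add0r; apply/andP; split; last exact: median_le.
  apply: (@le_trans _ _ 0%E); first by rewrite lee_fin oppr_le0 ltW.
  apply: median_ge0 => //; first exact: ltW.
rewrite -(fineK ux); set a := fine (u x).
apply: cvge_of_close => e e0.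
have th0 : 0 < Num.min gam (1 - gam) by rewrite lt_min gam0 subr_gt0.
apply: filterS (near_ac _ _ e0 th0) => r [r0].
rewrite -(fineK ux) -/a => lt1.
have lt2 : (mu (ball x r `&` [set y | (e%:E < `|u y - a%:E|)%E]) < gam%:E * mu (ball x r))%E.
  by apply: lt_le_trans lt1 _; rewrite lee_wpmul2r ?outer_measure_ge0// lee_fin ge_min lexx.
have lt3 : (mu (ball x r `&` [set y | (e%:E < `|u y - a%:E|)%E]) < (1 - gam)%:E * mu (ball x r))%E.
  by apply: lt_le_trans lt1 _; rewrite lee_wpmul2r ?outer_measure_ge0// lee_fin ge_min lexx orbT.
apply/andP; split.
  apply: le_median => b lt4; rewrite lee_fin leNgt; apply/negP => ba.
  have ab : gam + (1 - gam) <= 1 by lra.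
  have [p [xp A1 A2 Np]] := common_good_point r0 lt4 lt3 ab.
  move: A1 A2 => /=; rewrite -(fineK (fu Np)) -EFinB abse_EFin !lte_fin.
  move=> /negP; rewrite -leNgt => le1 /negP; rewrite -leNgt ler_distlC; lra.
apply: median_le; apply: le_lt_trans lt2.
apply: le_outer_measure => y [xy /= lt4]; split => //=.
case: (u y) lt4 => [b| |] //=; last by move=> _; exact: ltry.
rewrite !lte_fin => ab.
by rewrite ltr_normr ltrBrDl ab.
Unshelve. all: by end_near. Qed.

Context (q t : R).
Hypotheses (q0 : (0 < q)%R) (q1 : (q < 1)%R).

Definition series_vanishes (x : T) := forall e : R, 0 < e -> exists2 d : R, 0 < d &
  forall r, 0 < r -> r < d -> ((r `^ s)%:E * @median_series R T mu q t g x r <= e%:E)%E.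

(** Everything is compared with one point [p] where [g] is below a median [a] and
[u] is near [u x]: the gradient inequality brings [u y] near [u p] for each [y] with
[g y <= a], and [r ^ s * a] is small. *)
Lemma approximately_continuous_of_series x : mostly_near (mu := mu) u x ->
  series_vanishes x -> approximately_continuous x.
Proof.
move=> [ux near_x] sv eta theta eta0 theta0.
have m0 : 0 < Num.min theta 2^-1 by rewrite lt_min theta0 invr_gt0 ltr0n.
have qabs : `|q| < 1 by rewrite gtr0_norm.
have [i iP] : exists i, q ^+ i.+1 < Num.min theta 2^-1.
  have [n _ nP] := cvgr_lt 0 (cvg_expr qabs) _ m0.
  by exists n; exact: (nP n.+1 (leqnSn n)).
move: iP; rewrite lt_min => /andP[qtheta qhalf].
pose w := (q ^+ i.+1) `^ t.
have w0 : 0 < w by rewrite powR_gt0// exprn_gt0.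
have e0 : 0 < w * (eta / 24) by rewrite mulr_gt0// divr_gt0.
have [d1 d10 d1P] := sv _ e0.
have eta20 : 0 < eta / 2 by rewrite divr_gt0.
have [d2 d20 d2P] := near_x _ eta20.
exists (Num.min d1 d2); first by rewrite lt_min d10.
move=> r r0; rewrite lt_min => /andP[rd1 rd2].
have rs0 : 0 < r `^ s by rewrite powR_gt0.
(* for points at distance at most 3 r this level gives 3 r^s * 2 a = eta / 2 *)
pose a := eta / 12 / r `^ s.
have a0 : 0 < a by rewrite !divr_gt0.
have med_lt : (median mu (q ^+ i.+1) (EFin \o g) (ball x r) < a%:E)%E.
  have ge1 : (w%:E * median mu (q ^+ i.+1) (EFin \o g) (ball x r) <=
      @median_series R T mu q t g x r)%E.
    exact: median_series_ge.
  have := d1P r r0 rd1.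
  have rsE0 : (0 < (r `^ s)%:E)%E by rewrite lte_fin.
  rewrite -lee_pdivlMl// => /(le_trans ge1).
  rewrite -lee_pdivlMl// => /le_lt_trans; apply.
  rewrite -!EFinM lte_fin /a (_ : w^-1 * _ = eta / 24 / r `^ s); last first.
    by field; rewrite !gt_eqF.
  by rewrite ltr_pM2r ?invr_gt0// ltr_pM2l// ltf_pV2 ?posrE// ltr_nat.
have lt1 := lt_median med_lt.
apply: le_lt_trans
  (_ : (_ <= mu (ball x r `&` [set y | (a%:E < (EFin \o g) y)%E]))%E) _; last first.
  apply: lt_le_trans lt1 _.
  by rewrite lee_wpmul2r ?outer_measure_ge0// lee_fin ltW.
have le1 : q ^+ i.+1 + 2^-1 <= 1 by lra.
have [p [xp gp up Np]] := common_good_point r0 lt1 (d2P r r0 rd2) le1.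
move: gp up => /= /negP; rewrite -leNgt lee_fin => gp /contrapT.
rewrite -(fineK (fu Np)) -(fineK ux) -EFinB abse_EFin lte_fin => up.
rewrite -[leRHS]adde0 -N0; apply: le_trans (outer_measureU2 mu _ _).
apply: le_outer_measure => y [xy /= ltux].
have [Ny|Ny] := pselect (N y); [by right|left; split => //=].
rewrite lte_fin ltNge; apply/negP => gy.
move: ltux; rewrite -(fineK (fu Ny)) -EFinB abse_EFin lte_fin.
apply/negP; rewrite -leNgt.
have := grad Ny Np.
have dyp : mdist y p <= 3 * r.
  move: xy xp; rewrite !ballEmdist/= => xy xp.
  have := metric_triangle y x p; rewrite (metric_sym y x); lra.
have ag0 : 0 <= g y + g p by rewrite addr_ge0.
have := ler_wpM2r ag0 (powR_le3 s0 s1 (mdist_ge0 y p) (ltW r0) dyp).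
have ag : g y + g p <= 2 * a by lra.
have rs3 : 0 <= 3 * r `^ s by rewrite mulr_ge0// ltW.
have := ler_wpM2l rs3 ag.
have -> : 3 * r `^ s * (2 * a) = eta / 2.
  by rewrite /a; field; rewrite gt_eqF.
move=> h1 h2 h3.
have -> : fine (u y) - fine (u x) = (fine (u y) - fine (u p)) + (fine (u p) - fine (u x)) by ring.
apply: (le_trans (ler_normD _ _)); lra.
Qed.

End GeneralizedLebesguePoints.

(** * Chaining and Lebesgue points *)

Section LebesguePoints.
Context {R : realType} {T : pmetricType R}.
Context {mu : {outer_measure set T -> \bar R}} (s : R).
Hypothesis ball_pos : balls_pos_finite mu.
Hypothesis open_cara : forall U : set T, open U -> mu.-caratheodory U.
Hypotheses (s0 : 0 < s) (s1 : s <= 1).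
Context (u : T -> \bar R) (g : T -> R) (N : set T).
Hypothesis mu_u : mu_measurable_fun mu u.
Hypothesis mu_g : mu_measurable_fun mu (EFin \o g).
Hypothesis g0 : forall y, 0 <= g y.
Hypothesis N0 : mu N = 0%E.
Hypothesis fu : forall z, ~ N z -> u z \is a fin_num.
Hypothesis grad : forall z y, ~ N z -> ~ N y ->
  `|fine (u z) - fine (u y)| <= mdist z y `^ s * (g z + g y).
Context (c Q q : R).
Hypotheses (c0 : 0 < c) (Q0 : 0 < Q) (q0 : 0 < q) (q1 : q <= 2^-1).
Hypothesis ball_lower : forall (x z : T) (rho L : R), 0 < rho -> rho <= L -> mdist x z < L ->
  ((c * (rho / L) `^ Q)%:E * mu (ball x L) <= mu (ball z rho))%E.
Hypothesis q_chain : forall j, (q ^+ j.+1 / c) `^ Q^-1 <= 2^-1 ^+ j.+2.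

Section Chain.
Context (x : T) (L : R) (a : nat -> R).
Hypothesis L0 : 0 < L.
Hypothesis a_ge0 : forall i, 0 <= a i.
Hypothesis a_nd : forall i, a i <= a i.+1.
Hypothesis small_level : forall i,
  (mu (ball x L `&` [set y | (a i < g y)%R]) < (q ^+ i.+1)%:E * mu (ball x L))%E.

(** The radius at which the lower mass bound gives a ball of measure at least
[q ^ j * mu (ball x L)], more than the measure of the set where [g > a (j - 1)]. *)
Definition chain_step j : R := L * (q ^+ j / c) `^ Q^-1.

Lemma chain_step_le j : chain_step j.+1 <= L / 2 * 2^-1 ^+ j.+1.
Proof. by rewrite /chain_step -mulrA -exprS ler_pM2l. Qed.

Lemma chain_step_gt0 j : 0 < chain_step j.
Proof. by rewrite mulr_gt0// powR_gt0// divr_gt0// exprn_gt0. Qed.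

(** The ball of radius [chain_step j.+1] about [z] is too large to be covered by the
set where [g > a j]. The radii [L / 2 * (1 + 2^-1 ^+ j)] leave room for all the
steps inside [ball x L]. *)
Lemma chain_point j z : mdist x z < L / 2 * (1 + 2^-1 ^+ j.+1) ->
  exists z', [/\ mdist x z' < L / 2 * (1 + 2^-1 ^+ j), mdist z z' < chain_step j.+1,
    g z' <= a j & ~ N z'].
Proof.
move=> xz; have st := chain_step_le j; have st0 := chain_step_gt0 j.+1.
have e1 : 2^-1 ^+ j.+1 <= 2^-1 :> R by rewrite exprS ler_piMr// exprn_ile1//; lra.
have e2 : 2^-1 ^+ j = 2 * 2^-1 ^+ j.+1 :> R by rewrite exprS mulrA mulfV ?mul1r.
have e3 : 0 <= 2^-1 ^+ j.+1 :> R by rewrite exprn_ge0.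
have e4 : 2^-1 ^+ j <= 1 :> R by rewrite exprn_ile1//; lra.
have L20 : 0 < L / 2 by rewrite divr_gt0.
have m1 := ler_wpM2l (ltW L20) e1; have m4 := ler_wpM2l (ltW L20) e4.
have m2 : L / 2 * 2^-1 ^+ j = 2 * (L / 2 * 2^-1 ^+ j.+1) by rewrite e2; ring.
have xzL : mdist x z < L by move: xz; rewrite mulrDr mulr1; lra.
have stL : chain_step j.+1 <= L by lra.
have := ball_lower st0 stL xzL.
have -> : c * (chain_step j.+1 / L) `^ Q = q ^+ j.+1.
  rewrite /chain_step mulrAC mulfV ?gt_eqF// mul1r -powRrM mulVf ?gt_eqF// powRr1.
    by rewrite mulrC divfK// gt_eqF.
  by rewrite divr_ge0 ?exprn_ge0 ?(ltW q0) ?(ltW c0).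
move=> /(lt_le_trans (small_level j)) lt1.
apply: contrapT => /forallNP nz; move: lt1; apply/negP; rewrite -leNgt.
rewrite -[leRHS]adde0 -N0; apply: le_trans (outer_measureU2 mu _ _).
apply: le_outer_measure => z'; rewrite !ballEmdist/= => zz'.
have xz' : mdist x z' < L / 2 * (1 + 2^-1 ^+ j).
  apply: (le_lt_trans (metric_triangle x z z')).
  move: xz; rewrite !mulrDr !mulr1; lra.
have [gz|gz] := leP (g z') (a j).
  right; apply: contrapT => Nz'; exact: (nz z').
left; split => //=; apply: (lt_le_trans xz').
by rewrite mulrDr mulr1; lra.
Qed.

Context (p : T).
Hypotheses (xp : mdist x p < L) (gp : g p <= a 0%N) (Np : ~ N p).

Definition chain_weight i : R := 2 * chain_step i.+1 `^ s * a i.+1.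

Lemma chain_bound j z : ~ N z -> mdist x z < L / 2 * (1 + 2^-1 ^+ j) -> g z <= a j ->
  `|fine (u z) - fine (u p)| <= 6 * L `^ s * a 0%N + \sum_(i < j) chain_weight i.
Proof.
elim: j z => [|j IH] z Nz xz gz.
  rewrite big_ord0 addr0; apply: (le_trans (grad Nz Np)).
  have dzp : mdist z p <= 3 * L.
    have L0' := L0; have xp' := xp.
    have xzL : mdist x z < L.
      by apply: (lt_le_trans xz); rewrite expr0; lra.
    have := metric_triangle z x p; rewrite (metric_sym z x); lra.
  have gzp : 0 <= g z + g p by rewrite addr_ge0.
  apply: (le_trans (ler_wpM2r gzp (powR_le3 s0 s1 (mdist_ge0 z p) (ltW L0) dzp))).
  have -> : 6 * L `^ s * a 0%N = 3 * L `^ s * (2 * a 0%N) by ring.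
  by rewrite ler_wpM2l ?mulr_ge0 ?powR_ge0//; have gp' := gp; lra.
have [z' [xz' zz' gz' Nz']] := chain_point xz.
have le1 := IH z' Nz' xz' gz'.
have le2 : `|fine (u z) - fine (u z')| <= chain_weight j.
  apply: (le_trans (grad Nz Nz')); rewrite /chain_weight -mulrA mulrCA.
  apply: ler_pM; rewrite ?powR_ge0 ?addr_ge0//.
    by apply: ge0_ler_powR; rewrite ?nnegrE ?mdist_ge0 ?(ltW s0) ?(ltW (chain_step_gt0 _))// ltW.
  have := a_nd j; lra.
have -> : fine (u z) - fine (u p) = (fine (u z) - fine (u z')) + (fine (u z') - fine (u p)) by ring.
rewrite big_ord_recr/=.
apply: (le_trans (ler_normD _ _)); lra.
Qed.

Lemma chain_weight_ge0 i : 0 <= chain_weight i.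
Proof. by rewrite /chain_weight !mulr_ge0 ?powR_ge0. Qed.

(** Step [i] of the chain from [z] to [p] is needed only if [g z > a i]. *)
Definition chain_majorant y : \bar R :=
  (\sum_(i <oo) (chain_weight i)%:E * (\1_[set y | (a i < g y)%R] y)%:E)%E.

Lemma chain_term_ge0 i y :
  (0 <= (chain_weight i)%:E * (\1_[set y | (a i < g y)%R] y)%:E)%E.
Proof. by rewrite -EFinM lee_fin mulr_ge0 ?chain_weight_ge0// indicE. Qed.

Lemma chain_majorantP z j : ~ N z -> mdist x z < L / 2 -> g z <= a j ->
  ((`|fine (u z) - fine (u p)|)%:E <= (6 * L `^ s * a 0%N)%:E + chain_majorant z)%E.
Proof.
move=> Nz xz gzj.
have ex : exists j, g z <= a j by exists j.
case: (ex_minnP ex) => k gzk kmin.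
have xzk : mdist x z < L / 2 * (1 + 2^-1 ^+ k).
  by apply: (lt_le_trans xz); rewrite ler_peMr ?divr_ge0 ?(ltW L0)// lerDl exprn_ge0.
have le1 := chain_bound Nz xzk gzk.
apply: (@le_trans _ _ (6 * L `^ s * a 0%N + \sum_(i < k) chain_weight i)%:E).
  by rewrite lee_fin.
rewrite EFinD leeD2l//.
apply: le_trans (nneseries_lim_ge k (fun i _ _ => chain_term_ge0 i z)).
rewrite big_mkord -sumEFin; apply: lee_sum => i _.
rewrite indicE mem_set ?mule1//=.
by rewrite ltNge; apply/negP => /kmin; rewrite leqNgt ltn_ord.
Qed.

(** The points from which no chain starts. *)
Lemma bottomless_null :
  mu (ball x L `&` [set y | forall i, a i < g y]) = 0%E.
Proof.
apply/eqP; rewrite eq_le outer_measure_ge0 andbT.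
apply/lee_addgt0Pr => e e0; rewrite add0e.
have b0 := mball_gt0 ball_pos x L0.
have qabs : `|q| < 1 by rewrite gtr0_norm//; apply: (le_lt_trans q1); lra.
have eb0 : 0 < e / fine (mu (ball x L)) by rewrite divr_gt0.
have [n _ nP] := cvgr_lt 0 (cvg_expr qabs) _ eb0.
have := nP n.+1 (leqnSn n); rewrite /= ltr_pdivlMr// => lt1.
apply: (@le_trans _ _ (mu (ball x L `&` [set y | (a n < g y)%R]))).
  by apply: le_outer_measure => y [xy ay]; split => //; exact: ay.
apply: (le_trans (ltW (small_level n))).
by rewrite -(fineK (mball_fin ball_pos x L0)) -EFinM lee_fin ltW.
Qed.

Lemma measurable_level i : mu.-caratheodory [set y | (a i < g y)%R].
Proof.
have := emeasurable_fun_o_infty (@measurableT _ (caratheodory_type mu)) mu_g (a i)%:E.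
by rewrite setTI.
Qed.

Lemma measurable_mball (y : T) (r : R) : mu.-caratheodory (ball y r).
Proof. exact/open_cara/open_mball. Qed.

(** Integrating [chain_majorant] term by term: step [i] contributes its length times
the measure of the set where it is needed. *)
Lemma chain_integral (v eta : R) : 0 <= eta -> `|fine (u p) - v| <= eta ->
  (\int[cara_measure mu]_(y in ball x (L / 2)) `|u y - v%:E| <=
   ((eta + 6 * L `^ s * a 0%N)%:E +
     \sum_(i <oo) (chain_weight i * q ^+ i.+1)%:E) * mu (ball x L))%E.
Proof.
move=> eta0 pv.
have L20 : 0 < L / 2 by rewrite divr_gt0.
have K0 : 0 <= eta + 6 * L `^ s * a 0%N by rewrite addr_ge0// !mulr_ge0// powR_ge0.
have mterm i : @measurable_fun _ _ (caratheodory_type mu) _ (ball x (L / 2))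
    (fun y => (chain_weight i)%:E * (\1_[set y | (a i < g y)%R] y)%:E)%E.
  apply: (@measurable_funTS _ _ (caratheodory_type mu)).
  apply/measurable_EFinP/measurable_funM => //.
  by apply: measurable_indic; exact: measurable_level.
have mmaj : @measurable_fun _ _ (caratheodory_type mu) _ (ball x (L / 2)) chain_majorant.
  apply: (@emeasurable_fun_cvg _ (caratheodory_type mu) R _
    (fun n y => \sum_(0 <= i < n) (chain_weight i)%:E * (\1_[set y | (a i < g y)%R] y)%:E)%E).
    by move=> n; apply: emeasurable_sum.
  by move=> y _; apply: is_cvg_nneseries => i _ _; exact: chain_term_ge0.
have maj0 y : (0 <= chain_majorant y)%E.
  by apply: nneseries_ge0 => i _ _; exact: chain_term_ge0.
apply: (@le_trans _ _ (\int[cara_measure mu]_(y in ball x (L / 2))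
   (cst (eta + 6 * L `^ s * a 0%N)%:E y + chain_majorant y))%E).
  apply: (@ae_ge0_le_integral _ (caratheodory_type mu)).
  - exact: measurable_mball.
  - by [].
  - apply: (@measurable_funTS _ _ (caratheodory_type mu)).
    apply: measurableT_comp => //; apply: emeasurable_funB => //; exact: mu_u.
  - by move=> y _; rewrite adde_ge0//= lee_fin.
  - exact: emeasurable_funD.
  apply: (ae_off_null (outer_nullU N0 bottomless_null)).
  move=> y /not_orP[Ny ny] xy.
  have xy' : mdist x y < L / 2 by move: xy; rewrite ballEmdist.
  have [j gj] : exists j, g y <= a j.
    apply: contrapT => /forallNP nj; apply: ny; split.
      by rewrite ballEmdist/=; lra.
    by move=> i; rewrite ltNge; apply/negP; exact: nj.
  have := chain_majorantP Ny xy' gj.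
  rewrite -(fineK (fu Ny)) -EFinB abse_EFin /= EFinD -addeA => le1.
  apply: le_trans (leeD2l _ le1); rewrite -EFinD lee_fin.
  have -> : fine (u y) - v = (fine (u p) - v) + (fine (u y) - fine (u p)) by ring.
  by rewrite (le_trans (ler_normD _ _))// lerD2r.
rewrite ge0_integralD//; last exact: measurable_mball.
rewrite integral_cst; last exact: measurable_mball.
rewrite integral_nneseries//; last 2 first.
- exact: measurable_mball.
- by move=> i y _; exact: chain_term_ge0.
rewrite ge0_muleDl//; last first.
  by apply: nneseries_ge0 => i _ _; rewrite lee_fin mulr_ge0 ?chain_weight_ge0// exprn_ge0// ltW.
apply: leeD.
  rewrite lee_wpmul2l ?lee_fin//; apply: le_outer_measure => y; rewrite !ballEmdist/=; lra.
rewrite muleC -(fineK (mball_fin ball_pos x L0)) -nneseriesZl; last first.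
  by move=> i _; rewrite lee_fin mulr_ge0 ?chain_weight_ge0// exprn_ge0// ltW.
apply: lee_nneseries => [i _ _|i _].
  by apply: integral_ge0 => y _; exact: chain_term_ge0.
rewrite ge0_integralZl//; last 3 first.
- exact: measurable_mball.
- apply: (@measurable_funTS _ _ (caratheodory_type mu)).
  by apply/measurable_EFinP/measurable_indic; exact: measurable_level.
- by rewrite lee_fin chain_weight_ge0.
rewrite integral_indic; last 2 first.
- exact: measurable_mball.
- exact: measurable_level.
rewrite [leRHS]muleC (EFinM (chain_weight i)) -muleA lee_wpmul2l ?lee_fin ?chain_weight_ge0//.
rewrite fineK ?mball_fin//; apply: le_trans (ltW (small_level i)).
by apply: le_outer_measure => y [ay]; rewrite !ballEmdist/= => xy; split => //; lra.
Qed.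

End Chain.

Lemma median_antimono (gam gam' : R) (f : T -> \bar R) (A : set T) :
  gam' <= gam -> (median mu gam f A <= median mu gam' f A)%E.
Proof.
move=> gg; apply: le_median => b bP; apply: median_le; apply: (lt_le_trans bP).
by rewrite lee_wpmul2r ?outer_measure_ge0// lee_fin.
Qed.

Let t := 1 + s / Q.

Hypothesis qt : q `^ t <= 2^-1.

Definition oscillation_const : R := 6 / q `^ t + 2 * c^-1 `^ (s / Q) / q `^ t.

Lemma oscillation_const_gt0 : 0 < oscillation_const.
Proof. by rewrite addr_gt0// !mulr_gt0// ?invr_gt0 ?powR_gt0// invr_gt0. Qed.

Let w i : R := (q ^+ i.+1) `^ t.

Let w_gt0 i : 0 < w i.
Proof. by rewrite powR_gt0// exprn_gt0. Qed.

Let qn1 : q < 1.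
Proof. by apply: (le_lt_trans q1); rewrite invf_lt1// ltr1n. Qed.

(** The exponent [t = 1 + s / Q] splits into [s / Q], from the length of the step, and
[1], from the measure of the set where the step is made. *)
Lemma chain_weight_measure (L : R) (a : nat -> R) i : 0 < L ->
  chain_weight L a i * q ^+ i.+1 =
  2 * c^-1 `^ (s / Q) / q `^ t * L `^ s * (w i.+1 * a i.+1).
Proof.
move=> L0; rewrite /chain_weight /chain_step /w.
have qi0 : 0 < q ^+ i.+1 by rewrite exprn_gt0.
have -> : (L * (q ^+ i.+1 / c) `^ Q^-1) `^ s =
    L `^ s * ((q ^+ i.+1) `^ (s / Q) * c^-1 `^ (s / Q)).
  rewrite powRM ?powR_ge0 ?(ltW L0)//; congr (_ * _).
  by rewrite -powRrM powRM ?invr_ge0 ?(ltW c0) ?(ltW qi0)// (mulrC Q^-1).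
have -> : (q ^+ i.+2) `^ t = q `^ t * ((q ^+ i.+1) `^ (s / Q) * q ^+ i.+1).
  rewrite exprS powRM ?(ltW q0) ?(ltW qi0)//; congr (_ * _).
  by rewrite /t powRD ?(gt_eqF qi0) ?implybT// powRr1 ?(ltW qi0)// mulrC.
by field; rewrite gt_eqF// powR_gt0.
Qed.

(** The levels are [a i = median + 1] rather than the medians, so that the measures
of the superlevel sets are strictly below [q ^+ i.+1 * mu (ball x L)]; the
weights being summable, this costs [O (L ^ s)]. *)
Lemma oscillation_le (x : T) (L v eta Pb : R) : 0 < L -> 0 <= eta ->
  (@median_series R T mu q t g x L <= Pb%:E)%E ->
  (mu (ball x L `&` [set y | ~ (`|u y - v%:E| < eta%:E)%E]) < (2^-1)%:E * mu (ball x L))%E ->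
  (\int[cara_measure mu]_(y in ball x (L / 2)) `|u y - v%:E| <=
   (eta + oscillation_const * L `^ s * (Pb + 1))%:E * mu (ball x L))%E.
Proof.
move=> L0 eta0 PPb near_v.
pose m i := median mu (q ^+ i.+1) (EFin \o g) (ball x L).
have m0 i : (0 <= m i)%E.
  by apply: median_ge0 => //; rewrite exprn_ile1// ltW.
have wm i : ((w i)%:E * m i <= Pb%:E)%E.
  by apply: le_trans PPb; apply: median_series_ge.
have mfin i : m i \is a fin_num.
  rewrite ge0_fin_numE//; have := wm i.
  by rewrite -lee_pdivlMl// => /le_lt_trans; apply; rewrite -EFinM ltry.
pose a i := fine (m i) + 1.
have a_ge0 i : 0 <= a i by rewrite addr_ge0// fine_ge0.
have a_nd i : a i <= a i.+1.
  rewrite lerD2r fine_le//; apply: median_antimono.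
  by rewrite exprS ler_piMl ?exprn_ge0 ?(ltW q0)// ltW.
have small i : (mu (ball x L `&` [set y | (a i < g y)%R]) < (q ^+ i.+1)%:E * mu (ball x L))%E.
  have /lt_median : (m i < (a i)%:E)%E by rewrite -(fineK (mfin i)) lte_fin ltrDl.
  by [].
have le1 : q ^+ 1 + 2^-1 <= 1 by rewrite expr1; have q1' := q1; lra.
have [p [xp gp up Np]] := common_good_point ball_pos N0 L0 (small 0%N) near_v le1.
have {}xp : mdist x p < L by move: xp; rewrite ballEmdist.
have {}gp : g p <= a 0%N by move/negP: gp; rewrite -leNgt.
have {}up : `|fine (u p) - v| <= eta.
  have : (`|(fine (u p))%:E - v%:E| < eta%:E)%E.
    by rewrite (fineK (fu Np)); exact: contrapT up.
  by rewrite -EFinB abse_EFin lte_fin => /ltW.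
apply: (le_trans (chain_integral L0 a_ge0 a_nd small xp gp Np eta0 up)).
rewrite lee_wpmul2r ?outer_measure_ge0//.
have wa0 i : (0 <= (w i * a i)%:E)%E by rewrite lee_fin mulr_ge0// ltW.
have SP : (\sum_(i <oo) (w i * a i)%:E <= (Pb + 1)%:E)%E.
  have -> : (\sum_(i <oo) (w i * a i)%:E = \sum_(i <oo) ((w i)%:E * m i + (w i)%:E))%E.
    by apply: eq_eseriesr => i _; rewrite /a mulrDr mulr1 EFinD EFinM fineK.
  rewrite nneseriesD; last 2 first.
  - by move=> i _ _; rewrite mule_ge0// lee_fin ltW.
  - by move=> i _ _; rewrite lee_fin ltW.
  by rewrite EFinD leeD//; exact: weight_sum_le1.
have L_s0 : 0 <= L `^ s by exact: powR_ge0.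
have K1 : 0 <= 2 * c^-1 `^ (s / Q) / q `^ t.
  by rewrite mulr_ge0 ?mulr_ge0 ?invr_ge0 ?powR_ge0.
have tail : (\sum_(i <oo) (chain_weight L a i * q ^+ i.+1)%:E <=
    (2 * c^-1 `^ (s / Q) / q `^ t * L `^ s * (Pb + 1))%:E)%E.
  have -> : (\sum_(i <oo) (chain_weight L a i * q ^+ i.+1)%:E =
      \sum_(i <oo) (2 * c^-1 `^ (s / Q) / q `^ t * L `^ s)%:E * (w i.+1 * a i.+1)%:E)%E.
    by apply: eq_eseriesr => i _; rewrite chain_weight_measure// EFinM.
  rewrite nneseriesZl// [leRHS]EFinM lee_wpmul2l//.
    by rewrite lee_fin mulr_ge0.
  apply: le_trans SP.
  rewrite [leRHS](nneseries_recl (P := xpredT))// -(nneseries_addn 1)//.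
  rewrite [X in (_ <= _ + X)%E](_ : _ = \sum_(i <oo) (w i.+1 * a i.+1)%:E)%E.
    by rewrite leeDr.
  by apply: eq_eseriesr => i _; rewrite addn1.
apply: (le_trans (leeD2l _ tail)); rewrite -EFinD lee_fin.
have a0P : q `^ t * a 0%N <= Pb + 1.
  rewrite -lee_fin; apply: le_trans SP.
  have -> : q `^ t * a 0%N = w 0%N * a 0%N by rewrite /w expr1.
  by rewrite (nneseries_recl (P := xpredT))// leeDl// nneseries_ge0.
have : 6 * L `^ s * a 0%N <= 6 / q `^ t * L `^ s * (Pb + 1).
  have -> : 6 * L `^ s * a 0%N = 6 / q `^ t * L `^ s * (q `^ t * a 0%N).
    by field; rewrite gt_eqF// powR_gt0.
  by rewrite ler_wpM2l// mulr_ge0// mulr_ge0// invr_ge0 powR_ge0.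
rewrite /oscillation_const !mulrDl; lra.
Qed.

Definition oscillation_vanishes (x : T) := forall e : R, 0 < e -> exists2 d : R, 0 < d &
  forall r : R, 0 < r -> r < d ->
  (\int[cara_measure mu]_(y in ball x r) `|u y - u x| <= e%:E * mu (ball x r))%E.

Lemma oscillation_vanishes_of_series x : mostly_near (mu := mu) u x ->
  series_vanishes (mu := mu) s g q t x -> oscillation_vanishes x.
Proof.
move=> [ux near_x] sv e e0.
have kap0 : 0 < c * 2^-1 `^ Q by rewrite mulr_gt0// powR_gt0 ?invr_gt0.
have K0 := oscillation_const_gt0.
pose K2 := (c * 2^-1 `^ Q)^-1; have K20 : 0 < K2 by rewrite invr_gt0.
pose eta := e / (2 * K2); have eta0 : 0 < eta by rewrite divr_gt0// mulr_gt0.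
pose e1 := e / (4 * oscillation_const * K2).
have e10 : 0 < e1 by rewrite divr_gt0// !mulr_gt0.
have [d1 d10 d1P] := near_x eta eta0.
have [d2 d20 d2P] := sv e1 e10.
pose d3 := e1 `^ s^-1; have d30 : 0 < d3 by rewrite powR_gt0.
exists (Num.min (Num.min d1 d2) d3 / 2); first by rewrite divr_gt0// !lt_min d10 d20.
move=> r r0; rewrite ltr_pdivlMr// !lt_min => /andP[/andP[rd1 rd2] rd3].
pose L := r * 2; have L0 : 0 < L by rewrite mulr_gt0.
have Ls0 : 0 < L `^ s by rewrite powR_gt0.
have Lr : L / 2 = r by rewrite /L mulfK.
have Le1 : L `^ s <= e1.
  have <- : (e1 `^ s^-1) `^ s = e1 by rewrite -powRrM mulVf ?gt_eqF// powRr1// ltW.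
  by apply: ge0_ler_powR; rewrite ?nnegrE ?(ltW s0) ?(ltW L0) ?(ltW d30)// ltW.
have PPb : (@median_series R T mu q t g x L <= (e1 / L `^ s)%:E)%E.
  have := d2P L L0 rd2; rewrite -lee_pdivlMl// => /le_trans; apply.
  by rewrite -EFinM lee_fin mulrC.
have := d1P L L0 rd1; rewrite -{1}(fineK ux) => near_v.
have := oscillation_le L0 (ltW eta0) PPb near_v; rewrite Lr fineK// => /le_trans; apply.
have muL : (mu (ball x L) <= K2%:E * mu (ball x r))%E.
  rewrite lee_pdivlMl//.
  have rL : r <= L by rewrite /L; have r0' := r0; lra.
  have := @ball_lower x x r L r0 rL; rewrite mdistxx => /(_ L0).
  by rewrite (_ : r / L = 2^-1)// /L; field; rewrite gt_eqF.
apply: (le_trans (lee_wpmul2l _ muL)).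
  rewrite lee_fin addr_ge0 ?(ltW eta0)// mulr_ge0 ?mulr_ge0 ?(ltW K0) ?(ltW Ls0)//.
  by rewrite addr_ge0// divr_ge0 ?ltW.
rewrite muleA -EFinM lee_wpmul2r ?outer_measure_ge0// lee_fin.
have -> : eta + oscillation_const * L `^ s * (e1 / L `^ s + 1) =
    eta + oscillation_const * e1 + oscillation_const * L `^ s.
  by field; rewrite gt_eqF.
have le1 : oscillation_const * L `^ s <= oscillation_const * e1 by rewrite ler_pM2l.
have -> : e = (eta + oscillation_const * e1 + oscillation_const * e1) * K2.
  by rewrite /eta /e1; field; rewrite !gt_eqF.
by rewrite ler_pM2r// lerD2l.
Qed.

End LebesguePoints.

Section LebesguePointOfOscillation.
Context {R : realType} {T : pmetricType R}.
Context {mu : {outer_measure set T -> \bar R}}.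
Hypothesis ball_pos : balls_pos_finite mu.
Hypothesis open_cara : forall U : set T, open U -> mu.-caratheodory U.

Lemma lebesgue_point_of_oscillation (u : T -> \bar R) x : mu_measurable_fun mu u ->
  u x \is a fin_num -> oscillation_vanishes (mu := mu) u x -> lebesgue_point mu u x.
Proof.
move=> mu_u ux ov.
pose v := fine (u x); have uxE : u x = v%:E by rewrite fineK.
have mB r : measurable (ball x r : set (caratheodory_type mu)).
  exact/open_cara/open_mball.
have mD r : @measurable_fun _ _ (caratheodory_type mu) _ (ball x r) (fun y => u y - v%:E)%E.
  apply: (@measurable_funTS _ _ (caratheodory_type mu)).
  by apply: emeasurable_funB => //; exact: mu_u.
have near_ov e : 0 < e -> \forall r \near 0^'+, 0 < r /\
    (\int[cara_measure mu]_(y in ball x r) `|u y - v%:E| <= e%:E * mu (ball x r))%E.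
  move=> e0; have [d d0 dP] := ov e e0.
  near=> r.
  have r0 : 0 < r by near: r; exact: nbhs_right_gt.
  split => //; rewrite -uxE; apply: dP => //; near: r; exact: nbhs_right_lt.
have intD r e : 0 < r ->
    (\int[cara_measure mu]_(y in ball x r) `|u y - v%:E| <= e%:E * mu (ball x r))%E ->
    (cara_measure mu).-integrable (ball x r) (fun y => u y - v%:E)%E.
  move=> r0 le1; apply/integrableP; split => //.
  by apply: (le_lt_trans le1); rewrite -(fineK (mball_fin ball_pos x r0)) -EFinM ltry.
have intC r : 0 < r -> (cara_measure mu).-integrable (ball x r) (cst v%:E).
  move=> r0; apply/integrableP; split; first exact: measurable_cst.
  rewrite (_ : (fun y => _) = cst (`|v|%:E)) // integral_cst; last exact: mB.
  by rewrite /= -(fineK (mball_fin ball_pos x r0)) -EFinM ltry.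
have uE : u = (fun y => (u y - v%:E) + cst v%:E y)%E.
  by apply/funext => y; rewrite subeK.
split.
  apply: filterS (near_ov 1 ltr01) => r [r0 le1].
  rewrite uE; apply: integrableD => //; [exact: intD le1|exact: intC].
rewrite uxE; apply: cvge_of_close => e e0.
apply: filterS (near_ov e e0) => r [r0 le1].
have b0 := mball_gt0 ball_pos x r0; set b := fine _ in b0.
have bE : mu (ball x r) = b%:E by rewrite /b fineK// mball_fin.
have iD := intD _ _ r0 le1.
have -> : (\int[cara_measure mu]_(y in ball x r) u y =
    \int[cara_measure mu]_(y in ball x r) (u y - v%:E) + (v * b)%:E)%E.
  rewrite {1}uE integralD//; last exact: intC.
  rewrite integral_cst; last exact: mB.
  by rewrite EFinM -bE.
have le2 := le_trans (le_abse_integral (cara_measure mu) (mB r) (mD r)) le1.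
have := integrable_fin_num (mB r) iD; move: le2.
case: (\int[cara_measure mu]_(y in ball x r) (u y - v%:E))%E => // i le2 _.
rewrite bE inver gt_eqF// -EFinD -EFinM !lee_fin.
move: le2; rewrite bE abse_EFin -EFinM lee_fin => le2.
have -> : b^-1 * (i + v * b) = i / b + v by field; rewrite gt_eqF.
have : `|i / b| <= e by rewrite normrM normfV (gtr0_norm b0) ler_pdivrMr.
rewrite ler_norml => /andP[? ?]; apply/andP; split; lra.
Unshelve. all: by end_near. Qed.

End LebesguePointOfOscillation.

(** * The Boyd index and the choice of the ratio *)

Section BoydIndex.
Context {R : realType} {T : pmetricType R}.
Context {mu : {outer_measure set T -> \bar R}} (X : qbfs mu).

Lemma Phi_le_power (alpha : \bar R) (beta : R) : is_upper_boyd_index X alpha ->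
  (alpha < beta%:E)%E -> exists2 gam0 : R, 0 < gam0 &
  forall gam, 0 < gam -> gam < gam0 -> (Phi X gam <= (gam `^ (- beta))%:E)%E.
Proof.
move=> alphaP ab.
have /nbhs_ballP[d /= d0 dP] : \forall gam \near 0^'+,
    (lne (Phi X gam) / (ln gam^-1)%:E < beta%:E)%E.
  exact: (alphaP _ (open_ereal_lt' ab)).
exists (Num.min d 1); first by rewrite lt_min d0 ltr01.
move=> gam gam0; rewrite lt_min => /andP[gd g1].
have : (lne (Phi X gam) / (ln gam^-1)%:E < beta%:E)%E.
  by apply: dP => //; rewrite /ball/= sub0r normrN gtr0_norm.
have l0 : 0 < ln gam^-1 by rewrite ln_gt0// invf_gt1.
rewrite inver gt_eqF//.
case: (Phi X gam) => [r| |] /=; last by rewrite leNye.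
  case: ifPn => [r0 _|].
    by rewrite lee_fin (le_trans r0)// powR_ge0.
  rewrite -ltNge => r0; rewrite -EFinM lte_fin ltr_pdivrMr// => lt1.
  rewrite lee_fin /powR gt_eqF// -[leLHS]lnK ?posrE// ler_expR.
  by move: lt1; rewrite lnV ?posrE// mulrN mulNr => /ltW.
by rewrite mulyr gtr0_sg ?invr_gt0// mul1e.
Qed.

Lemma small_power (p e : R) : 0 < p -> 0 < e ->
  exists2 d : R, 0 < d & forall q, 0 < q -> q <= d -> q `^ p <= e.
Proof.
move=> p0 e0; exists (e `^ p^-1); first exact: powR_gt0.
move=> q q0 qd; have <- : (e `^ p^-1) `^ p = e.
  by rewrite -powRrM mulVf ?gt_eqF// powRr1// ltW.
by apply: ge0_ler_powR; rewrite ?nnegrE ?powR_ge0// ltW.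
Qed.

(** The smallness of [q] required by [chain_step_le]. *)
Lemma small_chain_ratio (c Q : R) : 0 < c -> 0 < Q ->
  exists2 d : R, 0 < d & forall q, 0 < q -> q <= d ->
    forall j, (q ^+ j.+1 / c) `^ Q^-1 <= 2^-1 ^+ j.+2.
Proof.
move=> c0 Q0; pose m := Num.min 1 c.
have m0 : 0 < m by rewrite lt_min ltr01.
have m1 : m <= 1 by rewrite ge_min lexx.
have mc : m <= c by rewrite ge_min lexx orbT.
have f0 : 0 < 4^-1 `^ Q :> R by rewrite powR_gt0 ?invr_gt0.
exists (m * 4^-1 `^ Q); first by rewrite mulr_gt0.
move=> q q0 qd j.
have le1 : q ^+ j.+1 / c <= (4^-1 ^+ j.+1) `^ Q.
  rewrite ler_pdivrMr//.
  apply: (@le_trans _ _ ((m * 4^-1 `^ Q) ^+ j.+1)).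
    by rewrite lerXn2r ?nnegrE ?mulr_ge0 ?(ltW q0) ?(ltW m0) ?(ltW f0).
  have -> : (4^-1 ^+ j.+1) `^ Q = (4^-1 `^ Q) ^+ j.+1 :> R.
    by rewrite -!powR_mulrn ?powR_ge0 ?invr_ge0// powRAC.
  rewrite exprMn mulrC ler_pM2l ?exprn_gt0//; apply: le_trans mc.
  by rewrite exprS ler_piMr ?exprn_ile1// ltW.
apply: (@le_trans _ _ (((4^-1 ^+ j.+1) `^ Q) `^ Q^-1)).
  apply: ge0_ler_powR; rewrite ?nnegrE ?powR_ge0 ?invr_ge0 ?(ltW Q0)//.
  by rewrite divr_ge0 ?exprn_ge0 ?(ltW q0) ?(ltW c0).
rewrite -powRrM mulfV ?gt_eqF// powRr1 ?exprn_ge0 ?invr_ge0//.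
have -> : 4^-1 = 2^-1 ^+ 2 :> R by rewrite exprVn -natrX.
rewrite -exprM; apply: ler_wiXn2l; rewrite ?invr_ge0 ?invf_le1 ?ler1n//.
by rewrite mulnS mul2n -addnn addnA leq_addr.
Qed.

End BoydIndex.

(** * The exceptional set *)

Section QuasieverywhereSeries.
Context {R : realType} {T : pmetricType R}.
Context {mu : {outer_measure set T -> \bar R}} (X : qbfs mu) (s kappa : R).
Hypothesis ball_pos : balls_pos_finite mu.
Hypothesis open_cara : forall U : set T, open U -> mu.-caratheodory U.
Hypothesis X_ac : absolutely_continuous_qnorm X.
Hypotheses (s0 : 0 < s) (s1 : s <= 1).
Hypothesis kappa0 : 0 < kappa.
Hypothesis kappa_ball : forall (x z : T) r, (0 < r)%R -> (mdist x z < r)%R ->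
  (kappa%:E * mu (ball z (2 * r)%R) <= mu (ball x r))%E.
Context (u : T -> \bar R) (g : T -> R) (N : set T).
Hypothesis mu_u : mu_measurable_fun mu u.
Hypothesis g0 : forall y, 0 <= g y.
Hypothesis Xg : qb_set X (EFin \o g).
Hypothesis N0 : mu N = 0%E.
Hypothesis fu : forall z, ~ N z -> u z \is a fin_num.
Hypothesis grad : forall z y, ~ N z -> ~ N y ->
  `|fine (u z) - fine (u y)| <= mdist z y `^ s * (g z + g y).
Hypothesis u_qc : quasicontinuous X s u.

(** Two uses of the Boyd index: [mostly_near] needs the maximal operator for a single
parameter, the median series needs the power bound along [q ^ i]. *)
Lemma quasieverywhere_series (alpha : \bar R) (beta t : R) :
  is_upper_boyd_index X alpha -> (alpha < beta%:E)%E -> beta < t -> 0 < t ->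
  exists2 d : R, 0 < d & forall q, 0 < q -> q <= d -> q `^ t <= 2^-1 /\
    cap_null X s [set x | ~ (mostly_near (mu := mu) u x /\
                             series_vanishes (mu := mu) s g q t x)].
Proof.
move=> alphaP ab bt t0.
have [gam0 gam00 PhiP] := Phi_le_power alphaP ab.
have [c c1 qtriangle] := qb_qtriangle X.
have c0 : 0 < c by rewrite (lt_le_trans ltr01).
have tb0 : 0 < t - beta by rewrite subr_gt0.
have ci0 : 0 < (2 * c)^-1 by rewrite invr_gt0 mulr_gt0.
have h0 : 0 < 2^-1 :> R by rewrite invr_gt0.
have [d1 d10 d1P] := small_power tb0 ci0.
have [d2 d20 d2P] := small_power t0 h0.
have near_null : cap_null X s [set x | ~ mostly_near (mu := mu) u x].
  pose gam := Num.min (gam0 / 2) (Num.min (kappa / 2) 1).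
  have gamgt0 : 0 < gam by rewrite !lt_min !divr_gt0//= ltr01.
  have gam_lt : gam < gam0.
    by rewrite /gam gt_min ltr_pdivrMr// ltr_pMr// ltr1n.
  have gam_kappa : gam <= kappa / 2 by rewrite /gam !ge_min lexx orbT.
  have gam1 : gam <= 1 by rewrite /gam !ge_min lexx !orbT.
  have PhiK := PhiP gam gamgt0 gam_lt.
  have C0 : 0 < c * (16 + 14 * gam `^ (- beta)).
    by rewrite mulr_gt0// ltr_wpDr// mulr_ge0// powR_ge0.
  apply: (mostly_near_qe ball_pos open_cara X_ac s0 s1 C0 _ c1 qtriangle
    mu_u g0 Xg N0 fu grad u_qc).
  move=> F h N' tau tau0 XF NF Xh Nh h0' N'0 grad'.
  exact: (capacity_half_filled ball_pos open_cara s0 s1 kappa_ball gam_kappa gam1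
    PhiK c1 qtriangle tau0 XF NF Xh Nh h0' N'0 grad').
pose d3 := Num.min (gam0 / kappa / 2) kappa^-1.
have d30 : 0 < d3 by rewrite lt_min invr_gt0 kappa0 !divr_gt0.
exists (Num.min 2^-1 (Num.min d3 (Num.min d1 d2))).
  by rewrite lt_min h0 lt_min d30 lt_min d10 d20.
move=> q q0; rewrite !le_min => /andP[qh /andP[/andP[qg qk] /andP[qd1 qd2]]].
have q1 : q < 1 by apply: (le_lt_trans qh); rewrite invf_lt1// ltr1n.
have qt := d2P q q0 qd2; split => //.
have kqgam : kappa * q < gam0.
  have : kappa * q <= gam0 / 2.
    apply: (le_trans (ler_wpM2l (ltW kappa0) qg)).
    by rewrite mulrA mulrCA mulfV ?gt_eqF// mulr1.
  move/le_lt_trans; apply; by rewrite ltr_pdivrMr// ltr_pMr// ltr1n.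
have kq1 : kappa * q <= 1.
  by apply: (le_trans (ler_wpM2l (ltW kappa0) qk)); rewrite mulfV ?gt_eqF.
have := median_series_vanishes ball_pos open_cara X_ac s0 s1 kappa_ball kappa0 q0 q1 qt
  c1 qtriangle PhiP kqgam kq1 (d1P q q0 qd1) g0 Xg.
move=> /(cap_nullU near_null); apply: cap_null_sub => x /= nx.
have [mx|] := pselect (mostly_near (mu := mu) u x); last by left.
by right => sx; apply: nx.
Qed.

End QuasieverywhereSeries.

Section Representatives.
Context {R : realType} {T : pmetricType R}.
Context {mu : {outer_measure set T -> \bar R}} (X : qbfs mu) (s : R).

Lemma hom_hajlasz_real_gradient (u : T -> \bar R) : hom_hajlasz X s u ->
  mu_measurable_fun mu u /\ exists (g : T -> R) (N : set T),
  [/\ forall y, 0 <= g y, qb_set X (EFin \o g), mu N = 0%E,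
      forall z, ~ N z -> u z \is a fin_num &
      forall z y, ~ N z -> ~ N y ->
        `|fine (u z) - fine (u y)| <= mdist z y `^ s * (g z + g y)].
Proof.
move=> [[mu_u ae_u] /ereal_inf_lt[_ [h [mh h0 [E E0 grad]] <-] hoo]]; split => //.
have Xh : qb_set X h.
  move: hoo; rewrite /normX /ext_norm; case: ifPn => [/set_mem//|_].
  by rewrite ltxx.
pose N := E `|` ([set x | ~ u x \is a fin_num] `|` [set x | h x \isn't a fin_num]).
exists (fine \o h), N; split.
- by move=> y; rewrite fine_ge0.
- by have [] := qb_fine Xh.
- by apply: outer_nullU => //; apply: outer_nullU; [exact: null_of_ae|exact: qb_fin Xh].
- by move=> z /not_orP[_ /not_orP[/contrapT]].
- move=> z y /not_orP[Ez /not_orP[/contrapT uz /negP/negPn hz]].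
  move=> /not_orP[Ey /not_orP[/contrapT uy /negP/negPn hy]].
  have := grad z y Ez Ey.
  rewrite -(fineK uz) -(fineK uy) -(fineK hz) -(fineK hy).
  by rewrite -lee_fin.
Qed.

End Representatives.

Theorem theorem1p3 (R : realType) (T : pmetricType R)
  (mu : {outer_measure set T -> \bar R})
  (mu_reg : borel_regular mu) (mu_ball : balls_pos_finite mu)
  (mu_dbl : doubling mu)
  (X : qbfs mu) (X_ac : absolutely_continuous_qnorm X)
  (c Q : R) (c_gt0 : 0 < c) (Q_gt0 : 0 < Q)
  (mass_bound : forall (x y : T) (r L : R), 0 < r -> r <= L -> ball x L y ->
    c * (r / L) `^ Q <= fine (mu (ball y r)) / fine (mu (ball x L)))
  (s : R) (s_gt0 : 0 < s) (s_le1 : s <= 1)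
  (u : T -> \bar R) (u_hom : hom_hajlasz X s u)
  (u_qc : quasicontinuous X s u)
  (alphaX : \bar R) (alphaXP : is_upper_boyd_index X alphaX) :
  ((alphaX < +oo)%E ->
     quasieverywhere X s (fun x => gen_lebesgue_point mu u x)) /\
  ((alphaX < ((Q + s) / Q)%:E)%E ->
     quasieverywhere X s (fun x => lebesgue_point mu u x)).
Proof.
have open_cara (U : set T) : open U -> mu.-caratheodory U.
  by move=> oU; apply: mu_reg.1; exact: sub_sigma_algebra.
have ball_lower (x z : T) (rho L : R) : 0 < rho -> rho <= L -> mdist x z < L ->
    ((c * (rho / L) `^ Q)%:E * mu (ball x L) <= mu (ball z rho))%E.
  move=> rho0 rhoL xz; have L0 := lt_le_trans rho0 rhoL.
  have xLz : ball x L z by rewrite ballEmdist.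
  have := mass_bound x z rho L rho0 rhoL xLz.
  rewrite -(fineK (mball_fin mu_ball x L0)) -(fineK (mball_fin mu_ball z rho0)).
  by rewrite -EFinM lee_fin ler_pdivlMr ?mball_gt0.
(* the mass bound for the radii r and 2 r *)
pose kappa := c * 2^-1 `^ Q.
have kappa0 : 0 < kappa by rewrite mulr_gt0// powR_gt0 invr_gt0.
have kappa_ball (x z : T) r : 0 < r -> mdist x z < r ->
    (kappa%:E * mu (ball z (2 * r)%R) <= mu (ball x r))%E.
  move=> r0 xz; have r2 : r <= 2 * r by rewrite ler_peMl ?(ltW r0)// ler1n.
  have zx : mdist z x < 2 * r by rewrite metric_sym (lt_le_trans xz).
  have := ball_lower z x r (2 * r) r0 r2 zx.
  by rewrite (_ : r / (2 * r) = 2^-1)//; field; rewrite gt_eqF.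
have [mu_u [g [N [g0 Xg N0 fu grad]]]] := hom_hajlasz_real_gradient u_hom.
have QE := quasieverywhere_series mu_ball open_cara X_ac s_gt0 s_le1 kappa0 kappa_ball
  mu_u g0 Xg N0 fu grad u_qc alphaXP.
split=> [alpha_fin|alpha_lt].
  have [beta [beta0 ab]] : exists beta, 0 <= beta /\ (alphaX < beta%:E)%E.
    case: (alphaX) alpha_fin => [a| |] // _; last by exists 0; split; [exact: lexx|exact: ltNyr].
    by exists (`|a| + 1); rewrite addr_ge0// lte_fin (le_lt_trans (ler_norm a))// ltrDl.
  have bt : beta < beta + 1 by rewrite ltrDl.
  have t0 : 0 < beta + 1 by rewrite ltr_wpDl.
  have [d d0 dP] := QE _ _ ab bt t0.
  pose q := Num.min d 2^-1.
  have q0 : 0 < q by rewrite lt_min d0 invr_gt0 ltr0n.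
  have q1 : q < 1 by rewrite gt_min invf_lt1// ltr1n orbT.
  have qd : q <= d by rewrite ge_min lexx.
  have [_] := dP q q0 qd; apply: cap_null_sub => x /= nx [mx sx]; apply: nx.
  apply: (approximately_continuous_gen_lebesgue mu_ball N0 fu) => //.
    by case: mx.
  exact: (approximately_continuous_of_series mu_ball s_gt0 s_le1 g0 N0 fu grad q0 q1 mx sx).
have tE : (Q + s) / Q = 1 + s / Q by field; rewrite gt_eqF.
have [beta [bt ab]] : exists beta, beta < 1 + s / Q /\ (alphaX < beta%:E)%E.
  rewrite tE in alpha_lt.
  case: (alphaX) alpha_lt => [a| |] //; last first.
    by exists 0; split; [rewrite addr_gt0 ?divr_gt0|exact: ltNyr].
  rewrite lte_fin => at_; exists ((a + (1 + s / Q)) / 2).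
  by rewrite lte_fin; split; [exact: (midf_lt at_).2|exact: (midf_lt at_).1].
have t0 : 0 < 1 + s / Q by rewrite addr_gt0 ?divr_gt0.
have [d d0 dP] := QE _ _ ab bt t0.
have [d' d'0 d'P] := small_chain_ratio c_gt0 Q_gt0.
pose q := Num.min (Num.min d d') 2^-1.
have q0 : 0 < q by rewrite !lt_min d0 d'0 invr_gt0 ltr0n.
have q1 : q <= 2^-1 by rewrite ge_min lexx orbT.
have qd : q <= d by rewrite !ge_min lexx.
have qd' : q <= d' by rewrite !ge_min lexx orbT.
have [qt] := dP q q0 qd; apply: cap_null_sub => x /= nx [mx sx]; apply: nx.
apply: (lebesgue_point_of_oscillation mu_ball open_cara mu_u); first by case: mx.
exact: (oscillation_vanishes_of_series mu_ball open_cara s_gt0 s_le1 mu_u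
  (qb_measurable Xg) g0 N0 fu grad c_gt0 Q_gt0 q0 q1 ball_lower (d'P q q0 qd') qt mx sx).
Qed.
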